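(* Let $\Sigma$ be an $n$-vertex signed bipartite graph that is controllable or almost controllable. Assume that the coefficient of the constant term (if $n$ is even) or of the linear term (if $n$ is odd) of $\chi(\Sigma;x)$ is $\pm 1$. If $2^{-\lfloor n/2\rfloor}\sqrt{\Delta_{\Sigma}}$ is a squarefree integer, then $\Sigma$ is determined by its generalized spectrum (DGS).
   Context: A signed graph $\Sigma=(G,\sigma)$ is a simple graph $G$ with a map $\sigma:E(G)\to\{+1,-1\}$; its adjacency matrix $A(\Sigma)=(a_{ij})$ has $a_{ij}=\sigma(ij)$ if $i,j$ are adjacent and $0$ otherwise. $\chi(\Sigma;x)=\det(xI-A(\Sigma))$ is the characteristic polynomial and $\Delta_\Sigma$ is its discriminant, i.e. $\prod_{i<j}(\alpha_j-\alpha_i)^2$ over the roots $\alpha_i$ of $\chi(\Sigma;x)$. The walk matrix is $W(\Sigma)=[e,Ae,\dots,A^{n-1}e]$ with $e$ the all-ones vector and $A=A(\Sigma)$; $\Sigma$ is controllable if $\operatorname{rank}W(\Sigma)=n$ and almost controllable if $\operatorname{rank}W(\Sigma)=n-1$. Two signed graphs $\Sigma_1,\Sigma_2$ on $n$ vertices are generalized cospectral if $\det(xI-A(\Sigma_1))=\det(xI-A(\Sigma_2))$ and $\det(xI-(J-I-A(\Sigma_1)))=\det(xI-(J-I-A(\Sigma_2)))$, where $J$ is the all-ones matrix. $\Sigma$ is DGS if every signed graph generalized cospectral with $\Sigma$ is isomorphic to $\Sigma$. *)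

(* Defs.v *)
From HB Require Import structures.
From mathcomp Require Import all_boot all_order all_fingroup all_algebra all_field.
Set Implicit Arguments.
Unset Strict Implicit.
Unset Printing Implicit Defensive.
Import Order.TTheory GRing.Theory Num.Theory.
Local Open Scope ring_scope.

(* The values of [sign] on non-adjacent pairs are irrelevant: every definition
   below consults [sign] on edges only. *)
Record signed_graph (n : nat) := SignedGraph {
  adj : rel 'I_n;
  adj_sym : symmetric adj;
  adj_irrefl : irreflexive adj;
  sign : 'I_n -> 'I_n -> int;
  sign_sym : forall i j, adj i j -> sign i j = sign j i;
  sign_pm1 : forall i j, adj i j -> sign i j = 1 \/ sign i j = -1
}.

Definition bipartite n (S : signed_graph n) : Prop :=
  exists c : 'I_n -> bool, forall i j, adj S i j -> c i != c j.

Definition isomorphic n (S T : signed_graph n) : Prop :=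
  exists s : 'S_n,
    (forall i j, adj S i j = adj T (s i) (s j)) /\
    (forall i j, adj S i j -> sign S i j = sign T (s i) (s j)).

Definition adjmx n (S : signed_graph n) : 'M[int]_n :=
  \matrix_(i, j) (if adj S i j then sign S i j else 0).

Definition chi n (S : signed_graph n) : {poly int} := char_poly (adjmx S).

Definition walkmx n (S : signed_graph n) : 'M[int]_n :=
  \matrix_(i, j) (adjmx S ^+ j *m (const_mx 1 : 'cV[int]_n)) i 0.

Definition walk_rank n (S : signed_graph n) : nat :=
  \rank (map_mx intr (walkmx S) : 'M[rat]_n).

Definition controllable n (S : signed_graph n) : Prop := walk_rank S = n.

(* rank n - 1, written without truncated subtraction *)
Definition almost_controllable n (S : signed_graph n) : Prop :=
  (walk_rank S).+1 = n.

Definition generalized_cospectral n (S T : signed_graph n) : Prop :=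
  char_poly (adjmx S) = char_poly (adjmx T) /\
  char_poly (const_mx 1 - 1%:M - adjmx S)
    = char_poly (const_mx 1 - 1%:M - adjmx T).

Definition DGS n (S : signed_graph n) : Prop :=
  forall T : signed_graph n, generalized_cospectral T S -> isomorphic T S.

(* The roots of a polynomial, listed with multiplicity. *)
Definition croots (p : {poly algC}) : seq algC :=
  sval (closed_field_poly_normal p).

(* There is no leading-coefficient factor: this is the discriminant of a monic
   polynomial only.  It does not depend on the order of [croots p]. *)
Definition discr (p : {poly algC}) : algC :=
  let r := croots p in
  \prod_(j < size r) \prod_(i < size r | (i < j)%N) (r`_j - r`_i) ^+ 2.

Definition Delta n (S : signed_graph n) : algC :=
  discr (map_poly intr (chi S)).

Definition squarefree (m : int) : Prop :=
  forall d : int, (d ^+ 2 %| m)%Z -> d \is a GRing.unit.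

(* Main.v *)
Require Import Defs.
From mathcomp Require Import all_boot all_order all_fingroup all_algebra all_field.
From mathcomp Require Import ring zify.
Set Implicit Arguments.
Unset Strict Implicit.
Unset Printing Implicit Defensive.
Import Order.TTheory GRing.Theory Num.Theory.
Local Open Scope ring_scope.

(** Order the vertices so that [A = A(Sigma)] is block anti-diagonal with blocks
    [M], [M^T], and let [N = M M^T], [phi = char_poly N].  Then
    [chi = x^e phi(x^2)] with [e <= 1], [phi(0) = +-1], and
    [Delta = +- 4^(n/2) d^2] with [d = det phi'(N)], so the hypothesis says that
    [d] is squarefree; being a discriminant up to sign, [d] is also odd.

    If [Sigma'] is generalized cospectral with [Sigma], there is a rational
    orthogonal [Q] with [Q A = A' Q] and [Q e = e]: it sends [A^k e] to [A'^k e]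
    and, in the almost controllable case, matches the two orthogonal
    complements, whose norms differ by a rational square.  It remains to prove
    that [Q] is integral, for then it is a permutation matrix.

    Let [l] be the least denominator of [Q] and [p | l] a prime.  The rows [u]
    of [l Q] span modulo [p] a nonzero totally isotropic [A]-invariant space, and
    [u f(A) u^T = 0 mod p^2] for every polynomial [f].  Such a space is killed by
    [chi'(A)], so the components [x] of [u] and [y] of [u A] in the smaller colour
    class lie in [ker phi'(N)] modulo [p].  For odd [p] that kernel has
    dimension at most 1, since [p^2] does not divide [d], and the congruences
    modulo [p^2] with [f = x^2 phi'(x^2)] and [f = x phi'(x^2)] yield
    [z phi'(N) z^T = 0 mod p^2] for a nonzero kernel vector [z], which forces
    [p^2 | d].  For [p = 2], [phi'(N)] is
    invertible, so no nonzero [N]-invariant subspace is isotropic, and the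
    congruences force [x = y = 0].  Either way [u A = 0] modulo [p], and then
    [u = 0] because [chi(0)] or [chi'(0)] is [+-1]. *)


(** * Isotropic invariant subspaces of self-adjoint matrices *)

Section CommutativeRing.
Variable R : comNzRingType.

Lemma horner_mx_intertwine m n (X : 'M[R]_(m.+1, n.+1)) A F g :
  X *m A = F *m X -> X *m horner_mx A g = horner_mx F g *m X.
Proof.
move=> XA; elim/poly_ind: g => [|g c IHg]; first by rewrite !rmorph0 mulmx0 mul0mx.
rewrite !rmorphD !rmorphM /= !horner_mx_X !horner_mx_C mulmxDr mulmxDl.
rewrite -scalar_mxC; congr (_ + _).
by rewrite -mulmxE mulmxA IHg -!mulmxA XA.
Qed.

Lemma trmx_horner_mx n (A : 'M[R]_n.+1) g :
  (horner_mx A g)^T = horner_mx A^T g.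
Proof.
elim/poly_ind: g => [|g c IHg]; first by rewrite !rmorph0 trmx0.
rewrite !rmorphD !rmorphM /= !horner_mx_X !horner_mx_C linearD /= tr_scalar_mx.
rewrite -mulmxE trmx_mul IHg; congr (_ + _).
exact: comm_mx_horner.
Qed.

Lemma sym_horner_mx n (A : 'M[R]_n.+1) : A^T = A ->
  forall g, (horner_mx A g)^T = horner_mx A g.
Proof. by move=> symA g; rewrite trmx_horner_mx symA. Qed.

Lemma horner_mx_comp n (A : 'M[R]_n.+1) g h :
  horner_mx A (g \Po h) = horner_mx (horner_mx A h) g.
Proof.
elim/poly_ind: g => [|g c IHg]; first by rewrite comp_poly0 !rmorph0.
rewrite comp_polyD comp_polyM comp_polyX comp_polyC !rmorphD !rmorphM /= IHg.
by rewrite !horner_mx_X !horner_mx_C.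
Qed.

Lemma horner_mx_eigen m n (X : 'M[R]_(m, n.+1)) A a g :
  X *m A = a *: X -> X *m horner_mx A g = g.[a] *: X.
Proof.
move=> XA; elim/poly_ind: g => [|g c IHg].
  by rewrite rmorph0 mulmx0 horner0 scale0r.
rewrite rmorphD rmorphM /= horner_mx_X horner_mx_C mulmxDr -mulmxE mulmxA IHg.
rewrite -scalemxAl XA scalerA hornerMXaddC scalerDl.
by rewrite -(mul_scalar_mx c X) scalar_mxC.
Qed.

Lemma char_poly_tr n (A : 'M[R]_n) : char_poly A^T = char_poly A.
Proof.
rewrite /char_poly -[RHS]det_tr; congr (\det _).
by rewrite /char_poly_mx linearB /= tr_scalar_mx map_trmx.
Qed.

(** The two sizes are kept apart so that [P] may lead to a block decomposition, whose size equals
    [n] only propositionally. *)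
Lemma char_poly_conj m n (P : 'M[R]_(m, n)) (P' : 'M[R]_(n, m)) (A : 'M[R]_n) :
  m = n -> P *m P' = 1%:M -> char_poly (P *m A *m P') = char_poly A.
Proof.
move=> eq_mn; subst m => PP'; have P'P := mulmx1C PP'.
pose Pp := map_mx polyC P; pose Pp' := map_mx polyC P'.
have PpPp' : Pp *m Pp' = 1%:M by rewrite -map_mxM PP' map_mx1.
rewrite /char_poly.
have -> : char_poly_mx (P *m A *m P') = Pp *m char_poly_mx A *m Pp'.
  rewrite /char_poly_mx !map_mxM mulmxBr mulmxBl; congr (_ - _).
  by rewrite scalar_mxC -mulmxA PpPp' mulmx1.
by rewrite !det_mulmx mulrAC -det_mulmx PpPp' det1 mul1r.
Qed.

(** Matrix determinant lemma with denominators cleared: the bordered matrix [K] is triangularized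
    once from the right and once from the left. *)
Lemma det_scalar_add_col_row n (d : R) (a : 'cV[R]_n) (b : 'rV[R]_n) :
  d * \det (d%:M + a *m b) = d ^+ n * (d + (b *m a) 0 0).
Proof.
pose K : 'M[R]_(n + 1) := block_mx d%:M (- a) b 1%:M.
have e1 : K *m block_mx 1%:M 0 (- b) 1%:M = block_mx (d%:M + a *m b) (- a) 0 1%:M.
  rewrite mulmx_block !mulmx1 !mul1mx !mulmx0 add0r mulmxN mulNmx opprK.
  by rewrite add0r subrr.
have e2 : block_mx 1%:M 0 (- b) d%:M *m K = block_mx d%:M (- a) 0 (d%:M + b *m a).
  rewrite mulmx_block !mulmx1 !mul1mx !mul0mx !addr0 mulNmx mulNmx mulmxN opprK.
  by rewrite scalar_mxC addNr addrC.
have := congr1 determinant e1; rewrite det_mulmx det_lblock !det_ublock !det1 !mulr1.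
move=> eK; have := congr1 determinant e2.
rewrite det_mulmx det_lblock det_ublock !det1 mul1r !det_scalar expr1 eK => ->.
by rewrite det_mx11 !mxE eqxx mulr1n.
Qed.

Lemma det_block_scalar p q (d : R) (X : 'M[R]_(p, q)) (Y : 'M[R]_(q, p)) :
  d ^+ p * \det (block_mx d%:M X Y d%:M)
    = d ^+ q * \det ((d ^+ 2)%:M - X *m Y).
Proof.
have e : block_mx d%:M X Y d%:M *m block_mx d%:M 0 (- Y) 1%:M
    = block_mx ((d ^+ 2)%:M - X *m Y) X 0 d%:M.
  rewrite mulmx_block !mulmx1 !mulmx0 !add0r mulmxN mulmxN -scalar_mxM.
  by rewrite scalar_mxC subrr expr2.
have := congr1 determinant e; rewrite det_mulmx det_lblock det_ublock det1 mulr1.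
by rewrite !det_scalar mulrC => ->; rewrite mulrC.
Qed.

End CommutativeRing.

Section Field.
Variable F : fieldType.

Lemma row_free_complement r s (X : 'M[F]_(r, r + s)) :
  row_free X -> exists Z : 'M_(s, r + s), col_mx X Z \in unitmx.
Proof.
move=> freeX; exists (dsubmx (row_ebase X)).
have eX : X = row_mx (col_ebase X) 0 *m row_ebase X.
  rewrite -{1}(mulmx_ebase X) (eqP freeX); congr (_ *m _).
  rewrite -[pid_mx r]/(pid_mx r : 'M[F]_(r, r + s)) pid_mx_row mul_mx_row.
  by rewrite mulmx1 mulmx0.
have -> : col_mx X (dsubmx (row_ebase X))
    = block_mx (col_ebase X) 0 0 1%:M *m row_ebase X.
  rewrite {1}eX -{3}[row_ebase X]vsubmxK -{1}[row_ebase X]vsubmxK.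
  by rewrite mul_row_col mul0mx addr0 mul_block_col !mul0mx addr0 add0r mul1mx.
rewrite unitmx_mul row_ebase_unit andbT unitmxE det_lblock det1 mulr1 -unitmxE.
exact: col_ebase_unit.
Qed.

(** Completing [X] by [Z] to a basis makes [A] block triangular; [G] is its action on the quotient.
    The last two clauses say that the rows of [X] and [Z] span, and that those of [Z] are
    independent modulo [X]. *)
Lemma char_poly_stable r n (X : 'M[F]_(r, n)) A B : row_free X -> X *m A = B *m X ->
  exists (s : nat) (Z : 'M_(s, n)) (H : 'M_(s, r)) (G : 'M_s),
   [/\ Z *m A = H *m X + G *m Z,
       char_poly A = char_poly B * char_poly G,
       forall u : 'rV_n, u *m X^T = 0 -> u *m Z^T = 0 -> u = 0
     & forall v : 'rV_s, (v *m Z <= X)%MS -> v = 0].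
Proof.
move=> freeX XA.
have len : (r <= n)%N by rewrite -(eqP freeX) rank_leq_col.
have en : n = (r + (n - r))%N by rewrite subnKC.
move: (n - r)%N en => s en; subst n.
have [Z Punit] := row_free_complement freeX.
set P := col_mx X Z in Punit.
exists s, Z, (lsubmx (Z *m A *m invmx P)), (rsubmx (Z *m A *m invmx P)).
have ZA : Z *m A = lsubmx (Z *m A *m invmx P) *m X + rsubmx (Z *m A *m invmx P) *m Z.
  by rewrite -mul_row_col hsubmxK mulmxKV.
split=> //; first last.
- move=> v /submxP[D vZ]; have : row_mx (- D) v *m P = 0.
    by rewrite mul_row_col vZ mulNmx addNr.
  move/(congr1 (mulmx^~ (invmx P))); rewrite /= mulmxK // mul0mx -row_mx0.
  by move/eq_row_mx => [].
- move=> u uX uZ; apply: (can_inj (mulmxK (_ : P^T \in unitmx))).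
    by rewrite unitmx_tr.
  by rewrite mul0mx tr_col_mx mul_mx_row uX uZ row_mx0.
rewrite -(@char_poly_conj _ _ _ P (invmx P) A) ?mulmxV //.
have -> : P *m A *m invmx P = block_mx B 0 (lsubmx (Z *m A *m invmx P))
     (rsubmx (Z *m A *m invmx P)).
  apply: (canLR (mulmxK Punit)).
  by rewrite /P mul_col_mx mul_block_col mul0mx addr0 -ZA XA.
rewrite /char_poly /char_poly_mx map_block_mx scalar_mx_block opp_block_mx.
by rewrite add_block_mx map_mx0 !oppr0 !add0r det_lblock.
Qed.

(** With [V] the row space of [X], [V <= V^perp] and [A] acts on [F^n / V^perp] as the
    transpose of its action [B] on [V]; hence the square. *)
Lemma isotropic_char_poly r n (X : 'M[F]_(r, n)) A B :
  A^T = A -> row_free X -> X *m A = B *m X -> X *m X^T = 0 ->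
  exists g, char_poly A = char_poly B ^+ 2 * g.
Proof.
move=> symA freeX XA XX.
have [s [Z [H [G [ZA charA XZ0 _]]]]] := char_poly_stable freeX XA.
(* The pairing [X *m Z^T] realizes [B] as the action of [G^T] on a stable subspace, so [char_poly B]
   divides [char_poly G]. *)
have YG : (X *m Z^T) *m G^T = B *m (X *m Z^T).
  apply: trmx_inj; rewrite trmx_mul trmxK !trmx_mul trmxK mulmxA.
  have -> : G *m Z *m X^T = Z *m A *m X^T.
    by rewrite ZA mulmxDl -(mulmxA H) XX mulmx0 add0r.
  by rewrite -!mulmxA; congr (_ *m _); rewrite -trmx_mul -XA trmx_mul symA.
have freeY : row_free (X *m Z^T).
  apply/inj_row_free => v vY.
  have vX0 : v *m X = 0.
    by apply: XZ0; rewrite -?mulmxA ?XX ?mulmx0.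
  by apply: (row_free_inj freeX); rewrite /= vX0 mul0mx.
have [s' [_ [_ [G' [_ charG _ _]]]]] := char_poly_stable freeY YG.
by exists (char_poly G'); rewrite charA -(char_poly_tr G) charG mulrA expr2.
Qed.

(** If [C] is the action on the row space, the square of [char_poly C] divides [char_poly A]; so
    [char_poly C] divides the derivative, and Cayley-Hamilton applies. *)
Lemma isotropic_horner_deriv r n (X : 'M[F]_(r, n.+1)) A B :
  A^T = A -> X *m A = B *m X -> X *m X^T = 0 ->
  X *m horner_mx A (char_poly A)^`() = 0.
Proof.
move=> symA XA XX.
suff: row_base X *m horner_mx A (char_poly A)^`() = 0.
  move=> X0; have /submxP[D ->] : (X <= row_base X)%MS by rewrite eq_row_base.
  by rewrite -mulmxA X0 mulmx0.
have /submxP[D eX] : (row_base X <= X)%MS by rewrite eq_row_base.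
have /submxP[B' XA'] : (row_base X *m A <= row_base X)%MS.
  by rewrite eq_row_base eX -mulmxA XA mulmxA submxMl.
have XX' : row_base X *m (row_base X)^T = 0.
  by rewrite eX trmx_mul -mulmxA [X *m _]mulmxA XX mul0mx mulmx0.
have freeX := row_base_free X.
move: (row_base X) B' freeX XA' XX' {eX D}; case: (\rank X) => [|q] Y C freeY YA YY.
  by rewrite [Y]flatmx0 mul0mx.
have [g charA] := isotropic_char_poly symA freeY YA YY.
have -> : (char_poly A)^`()
    = char_poly C * ((char_poly C)^`() * g *+ 2 + char_poly C * g^`()).
  by rewrite charA expr2 !derivM; ring.
rewrite rmorphM -mulmxE mulmxA (horner_mx_intertwine _ YA) Cayley_Hamilton.
by rewrite !mul0mx.
Qed.

End Field.

(** * Symmetric forms modulo p^2 *)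

Lemma adj_eq0 (F : fieldType) n (A : 'M[F]_n) : (\rank A < n.-1)%N -> \adj A = 0.
Proof.
move=> ltA; apply/matrixP => i j; rewrite !mxE /cofactor.
suff -> : \det (row' j (col' i A)) = 0 by rewrite mulr0.
apply: contraTeq ltA; rewrite -unitfE -unitmxE => /mxrank_unit {1}<-.
rewrite -leqNgt; apply: leq_trans (_ : \rank (col' i A) <= _)%N.
  have -> : row' j (col' i A) = rowsub (lift j) (col' i A).
    by apply/matrixP => a b; rewrite !mxE.
  exact/mxrankS/rowsub_sub.
rewrite -mxrank_tr tr_col' -[leqRHS]mxrank_tr.
have -> : row' i A^T = rowsub (lift i) A^T by apply/matrixP => a b; rewrite !mxE.
exact/mxrankS/rowsub_sub.
Qed.

Section Reduction.
Variable p : nat.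
Hypothesis p_pr : prime p.

Local Notation red := (map_mx (intr : int -> 'F_p)).

Lemma intr_Fp_eq0 (a : int) : (a%:~R == 0 :> 'F_p) = (p %| a)%Z.
Proof. by rewrite (dvdz_pcharf (pchar_Fp p_pr)). Qed.

Lemma red_eq0P m n (A : 'M[int]_(m, n)) :
  reflect (exists B, A = p%:Z *: B) (red A == 0).
Proof.
apply: (iffP eqP) => [/matrixP A0 | [B ->]]; last first.
  by apply/matrixP => i j; rewrite !mxE intrM -[p%:~R]/(p%:R) pchar_Fp_0 ?mul0r.
exists (\matrix_(i, j) (A i j %/ p)%Z); apply/matrixP => i j; rewrite !mxE mulrC divzK //.
by have := A0 i j; rewrite !mxE -intr_Fp_eq0 => ->.
Qed.

Lemma prime_dvdzM (a b : int) : (p %| a * b)%Z = (p %| a)%Z || (p %| b)%Z.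
Proof. by rewrite -!intr_Fp_eq0 intrM mulf_eq0. Qed.

Lemma prime_dvdzX (a : int) n : (p %| a ^+ n)%Z -> (p %| a)%Z.
Proof.
by rewrite -!intr_Fp_eq0 rmorphXn expf_eq0 => /andP[].
Qed.

(** In corank at least 2 the adjugate vanishes modulo [p]: [\adj C = p E] and [C E = c I] with
    [\det C = p c]. Taking determinants, [p] divides a power of [c], hence [c]. *)
Lemma rank_red n (C : 'M[int]_n) :
  ~~ (p%:Z ^+ 2 %| \det C)%Z -> (n.-1 <= \rank (red C))%N.
Proof.
apply: contraNleq => /[dup] ltn /adj_eq0; rewrite -map_mx_adj => /eqP/red_eq0P[E adjC].
case: n => [|n] in C ltn E adjC *; first by [].
have := mul_mx_adj C; rewrite adjC -scalemxAr => CE.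
have p0 : p%:Z != 0 by rewrite eqz_nat -lt0n prime_gt0.
have detC : \det C = p%:Z * (C *m E) 0 0.
  by have /matrixP/(_ 0 0) := CE; rewrite !mxE eqxx mulr1n.
set c := (C *m E) 0 0 in detC.
have {}CE : C *m E = c%:M.
  apply/matrixP => i j; apply: (mulfI p0); move/matrixP/(_ i j): CE.
  by rewrite !mxE detC => ->; rewrite mulrnAr.
have : (p %| c ^+ n.+1)%Z.
  by rewrite -det_scalar -CE det_mulmx detC -mulrA dvdz_mulr.
by move/prime_dvdzX => pc; rewrite detC expr2 dvdz_mul.
Qed.

Section SymmetricForm.
Variables (n : nat) (C : 'M[int]_n).
Hypothesis symC : C^T = C.

Let bil (x y : 'rV[int]_n) := (x *m C *m y^T) 0 0.

Let bilC x y : bil x y = bil y x.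
Proof.
rewrite /bil; have -> : y *m C *m x^T = (x *m C *m y^T)^T.
  by rewrite !trmx_mul trmxK symC mulmxA.
by rewrite [RHS]mxE.
Qed.

Let bilD x y z : bil x (y + z) = bil x y + bil x z.
Proof. by rewrite /bil linearD /= mulmxDr mxE. Qed.

Let bilZ a x y : bil x (a *: y) = a * bil x y.
Proof. by rewrite /bil linearZ /= -scalemxAr mxE. Qed.

Let bil_ker x y : red x *m red C = 0 -> (p %| bil x y)%Z.
Proof.
move=> /eqP; rewrite -map_mxM => /red_eq0P[v xC].
by rewrite /bil xC -scalemxAl mxE dvdz_mulr.
Qed.

Lemma kernel_line (x z : 'rV[int]_n) : ~~ (p%:Z ^+ 2 %| \det C)%Z ->
  red x != 0 -> red x *m red C = 0 -> red z *m red C = 0 ->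
  exists (a : int) z', z = a *: x + p%:Z *: z'.
Proof.
move=> pC x0 xC zC.
have detC0 : \det (red C) == 0 by apply/det0P; exists (red x).
have rk : (\rank (kermx (red C)) <= 1)%N.
  rewrite mxrank_ker leq_subLR.
  by have := rank_red pC; lia.
have xk : (red x <= kermx (red C))%MS by apply/sub_kermxP.
have [a za] : exists a, red z = a *: red x.
  apply/sub_rVP; apply: submx_trans (_ : kermx (red C) <= _)%MS.
    exact/sub_kermxP.
  by rewrite -(geq_leqif (mxrank_leqif_sup xk)) rank_rV x0.
exists (a : nat)%:Z; have /eqP/red_eq0P[z' zz'] : red (z - (a : nat)%:Z *: x) = 0.
  rewrite map_mxB map_mxZ za; apply/eqP; rewrite subr_eq0; apply/eqP.
  by congr (_ *: _); rewrite -[RHS]/((a : nat)%:R) natr_Zp.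
by exists z'; rewrite -zz' addrC subrK.
Qed.

(** If [p^2] does not divide [det C], the adjugate of [C] modulo [p] is a nonzero
    symmetric matrix with all rows proportional to [x]; write [x C = p v].  Then
    [v adj C] is a nonzero multiple of [x], but it vanishes because [v x^T = 0]. *)
Lemma dvdz_det_isotropic (x : 'rV_n) : red x != 0 -> red x *m red C = 0 ->
  (p%:Z ^+ 2 %| ((x *m C *m x^T) 0 0)%R)%Z -> (p%:Z ^+ 2 %| \det C)%Z.
Proof.
move=> x0 xC xx; apply: contraT => pC.
have p0 : p%:Z != 0 by rewrite eqz_nat -lt0n prime_gt0.
have detC0 : \det (red C) == 0 by apply/det0P; exists (red x).
have [d detC] : exists d, \det C = d * p%:Z.
  by apply/dvdzP; rewrite -intr_Fp_eq0 -det_map_mx.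
have pd : ~~ (p %| d)%Z by apply: contraNN pC => pd; rewrite detC expr2 dvdz_mul.
have /red_eq0P[v xCv] : red (x *m C) == 0 by rewrite map_mxM xC.
have vadj : v *m \adj C = d *: x.
  apply/matrixP => i j; apply: (mulfI p0).
  have /matrixP/(_ i j) : x *m C *m \adj C = (d * p%:Z) *: x.
    by rewrite -mulmxA mul_mx_adj detC mul_mx_scalar.
  rewrite xCv -scalemxAl !mxE => ->; ring.
have vx : red v *m (red x)^T = 0.
  rewrite map_trmx -map_mxM; apply/matrixP => i j; rewrite !ord1 !mxE.
  apply/eqP; rewrite intr_Fp_eq0 -(dvdz_mul2l p0) -expr2.
  by move: xx; rewrite xCv -scalemxAl mxE mxE.
have adj_ker : red (\adj C) *m red C = 0.
  by rewrite -map_mxM mul_adj_mx map_scalar_mx -det_map_mx (eqP detC0) raddf0.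
have [y adjy] : exists y : 'cV_n, red (\adj C) = y *m red x.
  have /fin_all_exists[f fE] i : exists a, row i (red (\adj C)) = a *: red x.
    have [|a [z' e]] := @kernel_line x (row i (\adj C)) pC x0 xC.
      by rewrite map_row -row_mul adj_ker row0.
    exists a%:~R; rewrite -map_row e map_mxD !map_mxZ /=.
    by rewrite -[p%:~R]/(p%:R) pchar_Fp_0 // scale0r addr0.
  exists (\col_i f i); apply/row_matrixP => i; rewrite fE row_mul.
  by apply/matrixP => a b; rewrite !mxE big_ord1 !mxE [a]ord1.
have : red (v *m \adj C) = 0.
  rewrite -symC -trmx_adj map_mxM -map_trmx adjy trmx_mul mulmxA vx.
  exact: mul0mx.
rewrite vadj map_mxZ => /eqP; rewrite scaler_eq0 (negPf x0) orbF intr_Fp_eq0.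
by rewrite (negPf pd).
Qed.

(** If [x] is nonzero modulo [p], write [y = b x + p y'], [x N = s x + p x'] and [x C x^T = p q],
    with [s] prime to [p]. The hypotheses modulo [p^2] become [p | s q + b^2 q] and, [p] being odd,
    [p | b q]; so [p | q], against [dvdz_det_isotropic]. Otherwise only [y C y^T] survives in the
    sum. *)
Lemma odd_kernel_pair (N : 'M_n) (x y : 'rV_n) :
  odd p -> N *m C = C *m N -> ~~ (p %| \det N)%Z ->
  ~~ (p%:Z ^+ 2 %| \det C)%Z -> red x *m red C = 0 -> red y *m red C = 0 ->
  (p%:Z ^+ 2 %| ((x *m N *m C *m x^T) 0 0 + (y *m C *m y^T) 0 0)%R)%Z ->
  (p%:Z ^+ 2 %| (2 * (x *m C *m y^T) 0 0)%R)%Z ->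
  red x = 0 /\ red y = 0.
Proof.
move=> odd_p NC pN pC xC yC.
have p0 : p%:Z != 0 by rewrite eqz_nat -lt0n prime_gt0.
rewrite -/(bil y y) -/(bil x y) => xxyy xy.
have [x0|x0] := eqVneq (red x) 0.
  split=> //; apply/eqP; apply: contraT => y0; case/negP: pC.
  apply: (dvdz_det_isotropic y0 yC); rewrite -/(bil y y).
  have /eqP/red_eq0P[z xz] := x0.
  move: xxyy; rewrite xz -!scalemxAl linearZ /= -!scalemxAr !mxE mulrA -expr2.
  by rewrite rpredDl // dvdz_mulr.
case/negP: (pC); apply: (dvdz_det_isotropic x0 xC); rewrite -/(bil x x).
have [b [y' ey]] := kernel_line pC x0 xC yC.
have [s [x' ex]] : exists (s : int) x', x *m N = s *: x + p%:Z *: x'.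
  apply: (kernel_line pC x0 xC).
  by rewrite -map_mxM -mulmxA NC mulmxA map_mxM map_mxM xC mul0mx.
have ps : ~~ (p %| s)%Z.
  apply: contraNN pN => ps; rewrite -intr_Fp_eq0 -det_map_mx; apply/det0P.
  exists (red x) => //; rewrite -map_mxM ex map_mxD !map_mxZ /=.
  rewrite -[p%:~R]/(p%:R) pchar_Fp_0 // scale0r addr0.
  by move: ps; rewrite -intr_Fp_eq0 => /eqP ->; rewrite scale0r.
have [q xx] : exists q, bil x x = q * p%:Z by apply/dvdzP; exact: bil_ker.
have [u xy'] : exists u, bil x y' = u * p%:Z by apply/dvdzP; exact: bil_ker.
have [w xx'] : exists u, bil x x' = u * p%:Z by apply/dvdzP; exact: bil_ker.
have exy : bil x y = p%:Z * (b * q + p%:Z * u).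
  by rewrite ey bilD !bilZ xx xy'; ring.
have eyy : bil y y = p%:Z * (b ^+ 2 * q + p%:Z * (b * u *+ 2 + bil y' y')).
  rewrite ey bilD !bilZ [bil _ x]bilC [bil _ y']bilC !bilD !bilZ (bilC y' x).
  by rewrite xx xy'; ring.
have exx : (x *m N *m C *m x^T) 0 0 = p%:Z * (s * q + p%:Z * w).
  by rewrite ex -/(bil _ x) bilC bilD !bilZ xx xx'; ring.
move: xy xxyy; rewrite exx eyy exy mulrCA -mulrDr expr2 !dvdz_mul2l // => p1 p2.
rewrite xx mulrC dvdz_mul2l //.
have {}p1 : (p %| b * q)%Z.
  have := p1; rewrite [X in is_true X -> _]prime_dvdzM => /orP[|].
    rewrite -[(p %| 2)%Z]/(p %| 2)%N dvdn_prime2 // => /eqP p2'.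
    by rewrite p2' in odd_p.
  by rewrite rpredDr ?(dvdz_mulr _ (dvdzz _)).
have {}p2 : (p %| s * q + b ^+ 2 * q)%Z.
  by move: p2; rewrite addrACA -mulrDr rpredDr ?(dvdz_mulr _ (dvdzz _)).
move: p1; rewrite prime_dvdzM => /orP[pb|//].
move: p2; rewrite rpredDr; last by rewrite expr2 -!mulrA dvdz_mulr.
by rewrite prime_dvdzM (negPf ps).
Qed.

End SymmetricForm.

End Reduction.

(** * Krylov spaces and repeated eigenvalues *)

Section Krylov.
Variables (F : fieldType) (n : nat) (N : 'M[F]_n.+1).
Hypothesis symN : N^T = N.

(** The vectors [z N^i] span an invariant totally isotropic space, which [isotropic_horner_deriv]
    shows to be killed by an invertible matrix. *)
Lemma isotropic_krylov (z : 'rV_n.+1) : horner_mx N (char_poly N)^`() \in unitmx ->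
  (forall h, z *m horner_mx N h *m z^T = 0) -> z = 0.
Proof.
move=> Cunit zz; set d := degree_mxminpoly N.
pose X := powers_mx N d *m lin_mul_row z.
have memX h : (z *m horner_mx N h <= X)%MS.
  by rewrite -mul_vec_lin_row submxMr ?horner_mx_mem.
have rowX i : row i X = z *m horner_mx N 'X^i.
  rewrite row_mul rowK mul_vec_lin_row rmorphXn /= horner_mx_X //.
have /submxP[B XN] : (X *m N <= X)%MS.
  apply/row_subP => i; rewrite row_mul rowX -mulmxA -{2}(horner_mx_X N).
  by rewrite mulmxE -rmorphM memX.
have XX : X *m X^T = 0.
  apply/row_matrixP => i; rewrite row_mul rowX row0; apply: trmx_inj.
  rewrite trmx_mul trmxK trmx0; apply/row_matrixP => j.
  rewrite row_mul rowX row0 trmx_mul sym_horner_mx // mulmxA -(mulmxA z).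
  by rewrite mulmxE -rmorphM zz.
have XC := isotropic_horner_deriv symN XN XX.
have X0 : X = 0 by rewrite -(mulmxK Cunit X) XC mul0mx.
by have := memX 1; rewrite X0 => /submx0null; rewrite rmorph1 mulmx1.
Qed.

(** Since [char_poly N = (X - a) char_poly G], the double root [a] is an eigenvalue of the quotient
    action [G]. A lift satisfies [z N = h x + a z]; pairing with [x] gives [h (x x^T) = 0], so
    [h = 0]. *)
Lemma eigenvector_orthogonal (x : 'rV_n.+1) a :
  x *m N = a *: x -> x *m x^T != 0 -> (char_poly N)^`().[a] = 0 ->
  exists2 z : 'rV_n.+1, z *m N = a *: z & ~~ (z <= x)%MS.
Proof.
move=> xN xx phia.
have x0 : x != 0 by apply: contraNneq xx => ->; rewrite mul0mx.
have freex : row_free x by rewrite /row_free rank_rV x0.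
have xN' : x *m N = a%:M *m x by rewrite mul_scalar_mx.
have [s [Z [H [G [ZN charN _ Zx]]]]] := char_poly_stable freex xN'.
have char1 : char_poly (a%:M : 'M_1) = 'X - a%:P.
  by rewrite /char_poly det_mx11 !mxE eqxx !mulr1n.
have /eigenvalueP[w wG w0] : eigenvalue G a.
  rewrite eigenvalue_root_char rootE -phia charN derivM char1 derivXsubC.
  by rewrite mul1r !hornerE subrr mul0r addr0.
have zN : w *m Z *m N = (w *m H) *m x + a *: (w *m Z).
  by rewrite -mulmxA ZN mulmxDr !mulmxA wG -scalemxAl.
exists (w *m Z); last by apply: contraNN w0 => /Zx ->.
rewrite zN; suff -> : w *m H = 0 by rewrite mul0mx add0r.
have : w *m Z *m N *m x^T = a *: (w *m Z) *m x^T.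
  rewrite -mulmxA; have -> : N *m x^T = a *: x^T.
    by rewrite -{1}symN -trmx_mul xN linearZ.
  by rewrite -scalemxAr -scalemxAl.
rewrite zN mulmxDl => /(canRL (addrK _)); rewrite subrr -mulmxA.
rewrite [w *m H]mx11_scalar mul_scalar_mx => /eqP; rewrite scaler_eq0 (negPf xx) orbF.
by move=> /eqP ->; rewrite raddf0.
Qed.

End Krylov.

(** * Characteristic two *)

Section CharacteristicTwo.
Variable F : finFieldType.
Hypothesis F2 : 2%:R = 0 :> F.

Lemma mulr2n_F2 (V : lmodType F) (v : V) : v *+ 2 = 0.
Proof. by rewrite -scaler_nat F2 scale0r. Qed.

Lemma oppr_F2 (V : lmodType F) (v : V) : - v = v.
Proof. by apply/eqP; rewrite eq_sym -addr_eq0 -mulr2n mulr2n_F2. Qed.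

(** Squaring is injective on polynomials in [N], as there are no isotropic vectors;
    by finiteness, iterated squaring is periodic at [N]. *)
Lemma horner_mx_square_root n (N : 'M[F]_n.+1) : N^T = N ->
  horner_mx N (char_poly N)^`() \in unitmx -> exists s, horner_mx N (s ^+ 2) = N.
Proof.
move=> symN Cunit.
have sq_inj g : horner_mx N (g ^+ 2) = 0 -> horner_mx N g = 0.
  move=> g2; apply/row_matrixP => i; rewrite row0.
  apply: (isotropic_krylov symN Cunit) => h.
  have ghg : horner_mx N g *m horner_mx N h *m horner_mx N g = 0.
    by rewrite !mulmxE -!rmorphM mulrAC -expr2 rmorphM /= g2 mul0r.
  rewrite rowE trmx_mul sym_horner_mx // mulmxA -(mulmxA _ _ (horner_mx N h)).
  by rewrite -(mulmxA _ _ (horner_mx N g)) ghg mulmx0 mul0mx.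
pose f i : 'M[F]_n.+1 := horner_mx N ('X ^+ (2 ^ i)).
have f_inj i j : f i.+1 = f j.+1 -> f i = f j.
  move=> fij; apply: subr0_eq; rewrite /f -raddfB; apply: sq_inj.
  rewrite sqrrB mulr2n_F2 subr0 -[X in _ + X]oppr_F2 -!exprM -!expnSr raddfB /=.
  by rewrite -/(f i.+1) fij subrr.
have /injectivePn[i [j nij fij]] : ~~ injectiveb (fun i : 'I_#|{: 'M[F]_n.+1}|.+1 => f i).
  by apply/injectiveP => /leq_card; rewrite card_ord ltnn.
wlog ltij : i j nij fij / (i < j)%N.
  move=> IH; case: (ltngtP i j) => [|ji|/val_inj eij]; first exact: IH.
    by apply: (IH j i) => //; rewrite eq_sym.
  by rewrite eij eqxx in nij.
have {nij fij} : f 0%N = f (j - i)%N.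
  move: (nat_of_ord i) (nat_of_ord j) ltij fij => {nij}{}i {}j.
  elim: i j => [|i IHi] [|j] //.
  by rewrite ltnS subSS => ltij /f_inj; exact: IHi.
rewrite -(subnSK ltij) /f expn0 expr1 horner_mx_X => eN.
by exists ('X ^+ (2 ^ (j - i.+1))); rewrite -exprM -expnSr.
Qed.

(** Let [S] be a square root of [N] among the polynomials in [N]. All forms [v h(N) v^T] vanish at
    [v = x S + y], as the two diagonal terms are equal and cancel. So [y = x S], and the mixed
    hypotheses then make [x S] isotropic too. *)
Lemma orthogonal_krylov_F2 n (N : 'M[F]_n.+1) (x y : 'rV_n.+1) : N^T = N ->
  N \in unitmx -> horner_mx N (char_poly N)^`() \in unitmx ->
  (forall h, x *m horner_mx N h *m y^T = 0) ->
  (forall h, x *m N *m horner_mx N h *m x^T = y *m horner_mx N h *m y^T) ->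
  x = 0 /\ y = 0.
Proof.
move=> symN Nunit Cunit xy xxyy; have [s sN] := horner_mx_square_root symN Cunit.
set S := horner_mx N s.
have symS : S^T = S := sym_horner_mx symN s.
have SS : S *m S = N by rewrite -[RHS]sN rmorphXn.
have yx h : y *m horner_mx N h *m x^T = 0.
  by apply: trmx_inj; rewrite !trmx_mul trmxK sym_horner_mx // mulmxA xy trmx0.
have xSy : x *m S + y = 0.
  apply: (isotropic_krylov symN Cunit) => h.
  rewrite linearD /= !mulmxDl !mulmxDr trmx_mul symS !mulmxA.
  have -> : x *m S *m horner_mx N h *m S *m x^T = y *m horner_mx N h *m y^T.
    rewrite -xxyy (_ : x *m N = x *m S *m S) -?mulmxA ?SS //.
    by congr (_ *m (_ *m _)); rewrite !mulmxA; congr (_ *m _); exact: comm_horner_mx2.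
  have -> : y *m horner_mx N h *m S *m x^T = 0.
    by rewrite -[y *m _ *m _]mulmxA mulmxE -rmorphM yx.
  have -> : x *m S *m horner_mx N h *m y^T = 0.
    by rewrite -[x *m _ *m _]mulmxA mulmxE -rmorphM xy.
  by rewrite addr0 add0r -mulr2n mulr2n_F2.
have xS : x *m S = 0.
  apply: (isotropic_krylov symN Cunit) => h.
  have ey : y = x *m S.
    by apply/eqP; rewrite -[x *m S]oppr_F2 -addr_eq0 addrC xSy.
  rewrite -{2}ey; rewrite -[x *m S *m _]mulmxA mulmxE -rmorphM; exact: xy.
split; last by rewrite -xSy xS add0r.
by apply: (can_inj (mulmxK Nunit)); rewrite -SS mulmxA xS !mul0mx.
Qed.

Hypothesis sqrF : forall c : F, c ^+ 2 = c.

Lemma comp_poly_X2_F2 (f : {poly F}) : f \Po 'X^2 = f ^+ 2.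
Proof.
elim/poly_ind: f => [|f c IHf]; first by rewrite comp_poly0 expr0n.
rewrite comp_polyD comp_polyM comp_polyX comp_polyC IHf sqrrD mulr2n_F2 addr0.
by rewrite exprMn -[c%:P ^+ 2]rmorphXn /= sqrF.
Qed.

(** If [f = a(X^2) + X b(X^2)], the derivative is [b(X^2) = b^2]. *)
Lemma deriv_F2_square (f : {poly F}) : exists t, f^`() = t ^+ 2.
Proof.
exists (odd_poly f); rewrite -comp_poly_X2_F2 -{1}[f]poly_even_odd derivD.
rewrite derivM !deriv_comp derivX derivXn /= expr1 !mulr2n_F2 !mulr0 !mul0r.
by rewrite add0r mulr1 add0r.
Qed.

(** In characteristic 2, [phi'] is a square [t^2], so [C = t(N)^2].  If the kernel
    of [C] were a line, spanned by [x], then either [x x^T = 0] and [x] lies in the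
    image of [C], or [N] splits along [x] and [x^perp] with a repeated eigenvalue. *)
Lemma rank_deriv_char_poly_F2 n (N : 'M[F]_n.+1) (C := horner_mx N (char_poly N)^`()) :
  N^T = N -> \det C = 0 -> (\rank C < n)%N.
Proof.
move=> symN detC; rewrite ltnNge; apply/negP => rkC.
have CE : C = horner_mx N (char_poly N)^`() by [].
clearbody C.
have [t dphi] := deriv_F2_square (char_poly N).
set T := horner_mx N t.
have CT : C = T *m T by rewrite CE dphi rmorphXn.
have symC : C^T = C by rewrite CE sym_horner_mx.
have symT : T^T = T by rewrite sym_horner_mx.
have detT : \det T == 0 by move: detC => /eqP; rewrite CT det_mulmx mulf_eq0 orbb.
have /det0P[x x0 xT] := detT.
have xC : x *m C = 0 by rewrite CT mulmxA xT mul0mx.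
have line (z : 'rV_n.+1) : z *m C = 0 -> exists a, z = a *: x.
  move=> zC; apply/sub_rVP; have xk : (x <= kermx C)%MS by apply/sub_kermxP.
  apply: submx_trans (_ : kermx C <= _)%MS; first exact/sub_kermxP.
  rewrite -(geq_leqif (mxrank_leqif_sup xk)) rank_rV x0 mxrank_ker leq_subLR.
  by rewrite addn1 ltnS.
have [a xN] : exists a, x *m N = a *: x.
  apply: line; rewrite -mulmxA CE (comm_mx_horner _ (erefl (N *m N) : comm_mx N N)).
  by rewrite mulmxA -CE xC mul0mx.
have phia : (char_poly N)^`().[a] = 0.
  apply/eqP; have := xC; rewrite CE (horner_mx_eigen _ xN) => /eqP.
  by rewrite scaler_eq0 (negPf x0) orbF.
have [xx|xx] := eqVneq (x *m x^T) 0; last first.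
  have [z zN] := eigenvector_orthogonal symN xN xx phia; case/negP.
  have [|b ->] := line z; last exact: scalemx_sub.
  by rewrite CE (horner_mx_eigen _ zN) phia scale0r.
have /submxP[w xw] : (x <= C)%MS.
  apply: submx_trans (_ : kermx x^T <= _)%MS; first exact/sub_kermxP.
  have Cx : (C <= kermx x^T)%MS.
    by apply/sub_kermxP; rewrite -[C]symC -trmx_mul xC trmx0.
  rewrite -(geq_leqif (mxrank_leqif_sup Cx)) mxrank_ker mxrank_tr rank_rV x0.
  by rewrite subn1.
(* As [w *m T *m C = x *m T = 0], the vector [w *m T] is a multiple of [x]; hence [x = w *m T *m T]
   is zero. *)
have [|b wT] := line (w *m T).
  by rewrite CT mulmxA -(mulmxA w) -CT -xw xT.
by move: x0; rewrite xw CT mulmxA wT -scalemxAl xT scaler0 eqxx.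
Qed.

End CharacteristicTwo.

Lemma coef0_comp_X2 (R : comNzRingType) (g : {poly R}) : (g \Po 'X^2)`_0 = g`_0.
Proof. by rewrite -!horner_coef0 horner_comp hornerXn expr0n. Qed.

Section SelfAdjoint.
Variables (n : nat) (N : 'M[int]_n.+1).
Hypothesis symN : N^T = N.
Let phi := char_poly N.
Let C := horner_mx N phi^`().

Lemma red_horner_mx p (g : {poly int}) :
  map_mx (intr : int -> 'F_p) (horner_mx N g)
    = horner_mx (map_mx intr N) (map_poly intr g).
Proof. exact: map_horner_mx. Qed.

Lemma red_deriv_char_poly p : map_mx (intr : int -> 'F_p) C
  = horner_mx (map_mx intr N) (char_poly (map_mx (intr : int -> 'F_p) N))^`().
Proof. by rewrite red_horner_mx -deriv_map -map_char_poly. Qed.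

(** [\det C] is, up to sign, the discriminant of [phi], so Stickelberger's theorem applies. *)
Lemma stickelberger : (2 %| \det C)%Z -> (2%:Z ^+ 2 %| \det C)%Z.
Proof.
move=> C2; apply: contraT => C4.
have p2 : prime 2 by [].
have := rank_red p2 C4; rewrite red_deriv_char_poly leqNgt rank_deriv_char_poly_F2 //.
- by rewrite pchar_Fp_0.
- by apply/eqfunP/forallP; case=> [[|[|[]]]] //= ?; apply/eqP/val_inj.
- by rewrite map_trmx symN.
- by apply/eqP; rewrite -red_deriv_char_poly det_map_mx intr_Fp_eq0.
Qed.

End SelfAdjoint.

(** * Half squares of bipartite matrices *)

Section Bipartite.
Variables (n k : nat) (A : 'M[int]_n.+1) (R : 'M[int]_(n.+1, k.+1)).
Hypotheses (symA : A^T = A) (RR : R^T *m R = 1%:M).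
Hypothesis bipA : R *m R^T *m A + A *m (R *m R^T) = A.

Variable N : 'M[int]_k.+1.
Hypothesis defN : N = R^T *m (A *m A) *m R.
Let phi := char_poly N.
Let C := horner_mx N phi^`().

Lemma sym_half_square : N^T = N.
Proof. by rewrite defN !trmx_mul trmxK symA !mulmxA. Qed.

(** Here [E = R R^T] projects onto one colour class and [bipA] says that [A] exchanges the classes;
    so [A^2] commutes with [E], and [N] is its restriction. *)
Lemma half_square_intertwine : (A *m A) *m R = R *m N.
Proof.
rewrite defN; set E := R *m R^T; have EA : E *m A = A - A *m E by rewrite -{2}bipA addrK.
have EAA : E *m (A *m A) = A *m A *m E.
  by rewrite mulmxA EA mulmxBl -(mulmxA A E A) EA mulmxBr subKr mulmxA.
by rewrite !mulmxA -/E -(mulmxA E) EAA -!mulmxA RR mulmx1.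
Qed.

Lemma half_square_horner g : horner_mx A (g \Po 'X^2) *m R = R *m horner_mx N g.
Proof.
rewrite horner_mx_comp rmorphXn /= horner_mx_X expr2 -mulmxE.
apply: trmx_inj; rewrite !trmx_mul !trmx_horner_mx; apply: horner_mx_intertwine.
by rewrite -trmx_mul half_square_intertwine trmx_mul.
Qed.

(** [u R] is the component of [u] in the class of [R], and [u A R] is the other component carried
    over by [A]; [bipA] recombines the two. *)
Lemma even_form g (u : 'rV_n.+1) :
  u *m R *m N *m horner_mx N g *m (u *m R)^T
    + u *m A *m R *m horner_mx N g *m (u *m A *m R)^T
  = u *m horner_mx A ('X^2 * (g \Po 'X^2)) *m u^T.
Proof.
set G := horner_mx A (g \Po 'X^2).
have GA : G *m A = A *m G by apply/esym/comm_mx_horner.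
rewrite rmorphM rmorphXn /= horner_mx_X -/G expr2 -!mulmxE !trmx_mul symA.
rewrite -(mulmxA u R) -half_square_intertwine !mulmxA.
rewrite -(mulmxA _ R (horner_mx N g)) -half_square_horner -/G.
rewrite -[u *m A *m R *m _]mulmxA -half_square_horner -/G !mulmxA -mulmxDl.
congr (_ *m _); rewrite -!(mulmxA u) -mulmxDr; congr (_ *m _).
rewrite -!(mulmxA A) -mulmxDr; congr (_ *m _).
by rewrite !mulmxA -GA -!mulmxA -mulmxDr addrC (mulmxA R) bipA.
Qed.

Lemma odd_form g (u : 'rV_n.+1) :
  u *m R *m horner_mx N g *m (u *m A *m R)^T
    + u *m A *m R *m horner_mx N g *m (u *m R)^T
  = u *m horner_mx A ('X * (g \Po 'X^2)) *m u^T.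
Proof.
set G := horner_mx A (g \Po 'X^2).
have GA : G *m A = A *m G by apply/esym/comm_mx_horner.
rewrite rmorphM /= horner_mx_X -/G -!mulmxE !trmx_mul symA.
rewrite -[u *m R *m _]mulmxA -[u *m A *m R *m _]mulmxA -half_square_horner -/G.
rewrite !mulmxA -mulmxDl; congr (_ *m _).
rewrite -!(mulmxA u) -mulmxDr; congr (_ *m _).
by rewrite -!GA -!mulmxA -mulmxDr !mulmxA -(mulmxA A) bipA.
Qed.

Section PrimeLevel.
Variables (p m : nat) (Q : 'M[int]_(m, n.+1)) (B : 'M[int]_m).
Hypotheses (p_pr : prime p) (pC : ~~ (p%:Z ^+ 2 %| \det C)%Z).
Hypothesis charA : char_poly A = phi \Po 'X^2 \/ char_poly A = 'X * (phi \Po 'X^2).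
Hypothesis phi0 : phi`_0 = 1 \/ phi`_0 = -1.
Hypothesis QA : Q *m A = B *m Q.
Hypothesis QQ : forall f, exists D, Q *m horner_mx A f *m Q^T = p%:Z ^+ 2 *: D.

Local Notation red := (map_mx (intr : int -> 'F_p)).

Let symN := sym_half_square.

Lemma det_half_square : ~~ (p %| \det N)%Z.
Proof.
have : \det N = 1 \/ \det N = -1.
  move: phi0; rewrite char_poly_det -signr_odd.
  by case: odd; rewrite ?expr0 ?expr1 ?mul1r ?mulN1r; case=> /eqP;
    rewrite ?eqr_oppLR ?opprK => /eqP; [right | left | left | right].
by case=> ->; rewrite ?rpredN /= -[(p %| 1)%Z]/(p %| 1)%N Euclid_dvd1.
Qed.

Let red_N_unit : red N \in unitmx.
Proof. by rewrite unitmxE unitfE det_map_mx intr_Fp_eq0 // det_half_square. Qed.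

Let redZp m1 m2 (X : 'M[int]_(m1, m2)) : red (p%:Z *: X) = 0.
Proof. by apply/eqP/(red_eq0P p_pr); exists X. Qed.

Lemma red_kill : red (Q *m horner_mx A (char_poly A)^`()) = 0.
Proof.
rewrite map_mxM red_horner_mx -deriv_map map_char_poly.
apply: (@isotropic_horner_deriv _ _ _ _ _ (red B)).
- by rewrite map_trmx symA.
- by rewrite -!map_mxM QA.
have [D] := QQ 1; rewrite rmorph1 mulmx1 map_trmx -map_mxM => ->.
by rewrite expr2 -scalerA redZp.
Qed.

(** According to the parity, [chi'] is [2 x phi'(x^2)] or [phi(x^2) + 2 x^2 phi'(x^2)]. Multiplying
    by [x^2] or [x], and subtracting [chi] in the second case, yields one polynomial for both. *)
Lemma red_kill3 : red (Q *m horner_mx A (('X ^+ 3 * (phi^`() \Po 'X^2)) *+ 2)) = 0.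
Proof.
have dX2 : (phi \Po 'X^2)^`() = (phi^`() \Po 'X^2) * 'X *+ 2.
  by rewrite deriv_comp derivXn /= expr1 mulrnAr.
case: charA => eA.
  have -> : 'X ^+ 3 * (phi^`() \Po 'X^2) *+ 2 = (char_poly A)^`() * 'X ^+ 2.
    by rewrite eA dX2; ring.
  by rewrite rmorphM -mulmxE mulmxA map_mxM red_kill mul0mx.
have -> : 'X ^+ 3 * (phi^`() \Po 'X^2) *+ 2 = (char_poly A)^`() * 'X - char_poly A.
  by rewrite eA derivM derivX dX2; ring.
rewrite rmorphB rmorphM /= Cayley_Hamilton subr0 -mulmxE mulmxA map_mxM red_kill.
exact: mul0mx.
Qed.

Let cross g (u : 'rV_n.+1) (x := u *m R) (y := u *m A *m R) :
  (exists D, u *m horner_mx A ('X * (g \Po 'X^2)) *m u^T = p%:Z ^+ 2 *: D) ->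
  (p%:Z ^+ 2 %| (2 * (x *m horner_mx N g *m y^T) 0 0)%R)%Z.
Proof.
case=> D uD; have := odd_form g u; rewrite uD -/x -/y; clearbody x y.
have -> : y *m horner_mx N g *m x^T = (x *m horner_mx N g *m y^T)^T.
  by rewrite !trmx_mul trmxK sym_horner_mx ?mulmxA //.
move/matrixP/(_ 0 0); rewrite [LHS]mxE [(_^T) 0 0]mxE [RHS]mxE => e.
by apply/dvdzP; exists (D 0 0); rewrite [RHS]mulrC -e; ring.
Qed.

Let diagonal g (u : 'rV_n.+1) (x := u *m R) (y := u *m A *m R) :
  (exists D, u *m horner_mx A ('X^2 * (g \Po 'X^2)) *m u^T = p%:Z ^+ 2 *: D) ->
  (p%:Z ^+ 2 %| ((x *m N *m horner_mx N g *m x^T) 0 0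
                + (y *m horner_mx N g *m y^T) 0 0)%R)%Z.
Proof.
case=> D uD; have := even_form g u; rewrite uD -/x -/y.
move/matrixP/(_ 0 0); rewrite [LHS]mxE [RHS]mxE => ->; exact: dvdz_mulr.
Qed.

(** Meant for [Q] an orthogonal matrix times its least denominator, with [p] dividing the latter;
    the conclusion contradicts minimality. *)
Lemma red_level : red Q = 0.
Proof.
have rowsQ i : red (row i Q *m R) = 0 /\ red (row i Q *m A *m R) = 0.
  set u := row i Q; set x := u *m R; set y := u *m A *m R.
  have uu f : exists D, u *m horner_mx A f *m u^T = p%:Z ^+ 2 *: D.
    have [D QD] := QQ f; exists (row i (col i D)).
    apply/matrixP => a b; rewrite !mxE !ord1 -[in RHS]/((p%:Z ^+ 2) * D i i).
    have /matrixP/(_ i i) := QD; rewrite [RHS]mxE => <-.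
    by rewrite -row_mul mxE; apply: eq_bigr => j _; rewrite !mxE.
  have even_uu g := @diagonal g u (uu _).
  have odd_uu g := @cross g u (uu _).
  have [odd_p|even_p] := boolP (odd p).
    have NC : N *m C = C *m N by exact: comm_mx_horner.
    have two0 : 2%:R != 0 :> 'F_p.
      rewrite -[2%:R]/((2%:Z)%:~R) intr_Fp_eq0 // -[(p %| 2)%Z]/(p %| 2)%N.
      by rewrite dvdn_prime2 //; apply: contraTneq odd_p => ->.
    (* For odd [p] the factor 2 cancels. What remains is [u A^3 phi'(A^2)]; times [R] it is [y N C],
       times [A R] it is [x N N C]. *)
    have kill : red (u *m horner_mx A ('X * (('X * phi^`()) \Po 'X^2))) = 0.
      have : red (u *m horner_mx A (('X ^+ 3 * (phi^`() \Po 'X^2)) *+ 2)) = 0.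
        by rewrite -row_mul map_row red_kill3 row0.
      rewrite (_ : 'X ^+ 3 * _ = 'X * (('X * phi^`()) \Po 'X^2)); last first.
        by rewrite comp_polyM comp_polyX; ring.
      rewrite mulr2n rmorphD mulmxDr map_mxD -mulr2n -scaler_nat => /eqP.
      by rewrite scaler_eq0 (negPf two0) => /eqP.
    have NyC : u *m horner_mx A ('X * (('X * phi^`()) \Po 'X^2)) *m R = y *m N *m C.
      rewrite rmorphM /= horner_mx_X -mulmxE -!mulmxA half_square_horner.
      by rewrite rmorphM /= horner_mx_X -mulmxE !mulmxA.
    have NxC : u *m horner_mx A ('X * (('X * phi^`()) \Po 'X^2)) *m A *m R
        = x *m N *m N *m C.
      rewrite -(mulmxA u) -{2}(horner_mx_X A) mulmxE -rmorphM /=.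
      rewrite (_ : _ * 'X = ('X ^+ 2 * phi^`()) \Po 'X^2); last first.
        by rewrite !comp_polyM !comp_polyX; ring.
      rewrite -mulmxA half_square_horner rmorphM rmorphXn /= horner_mx_X.
      by rewrite expr2 -!mulmxE !mulmxA.
    have yC : red y *m red C = 0.
      rewrite -(mulmxK red_N_unit (_ *m _)) -(mulmxA (red y)) -map_mxM -NC.
      by rewrite -map_mxM mulmxA -NyC map_mxM kill !mul0mx.
    have NNC : C *m N *m N = N *m N *m C by rewrite -NC -(mulmxA N C) -NC mulmxA.
    have xCNN : red (x *m (C *m N *m N)) = 0.
      by rewrite NNC !mulmxA -NxC map_mxM (map_mxM _ _ A) kill !mul0mx.
    have xC : red x *m red C = 0.
      move: xCNN; rewrite !map_mxM !mulmxA => /(canRL (mulmxK red_N_unit)).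
      by rewrite mul0mx => /(canRL (mulmxK red_N_unit)); rewrite mul0mx.
    have [] := @odd_kernel_pair p p_pr _ C _ N x y odd_p NC det_half_square pC xC yC _ _ => //.
    - exact: sym_horner_mx.
    - exact: even_uu.
    - exact: odd_uu.
  have p2 : p = 2%N by case/even_prime: p_pr even_p => [-> | ->].
  have two0 : 2%:R = 0 :> 'F_p by rewrite -[in 2%:R]p2 pchar_Fp_0.
  have p0 : p%:Z != 0 by rewrite eqz_nat -lt0n prime_gt0.
  have lift (h : {poly 'F_p}) : exists g : {poly int}, h = map_poly intr g.
    exists (map_poly (fun a : 'F_p => (a : nat)%:Z) h); apply/polyP => j.
    rewrite coef_map /= coef_map_id0 //; move: (h`_j) => a.
    by rewrite -[RHS]/((nat_of_ord a)%:R) natr_Zp.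
  have red11 (X : 'M[int]_1) : (p %| X 0%R 0%R)%Z -> red X = 0.
    rewrite -(intr_Fp_eq0 p_pr) => /eqP X0.
    by apply/matrixP => a b; rewrite !ord1 !mxE X0.
  apply: (orthogonal_krylov_F2 two0 _ red_N_unit).
  - by rewrite map_trmx symN.
  - rewrite -red_deriv_char_poly unitmxE unitfE det_map_mx intr_Fp_eq0 //.
    by apply: contraNN pC; rewrite p2; exact: stickelberger.
  (* The factor 2 in [odd_uu] is [p] itself; dividing by it leaves a congruence modulo [p]. *)
  - move=> h; have [g ->] := lift h; rewrite -red_horner_mx map_trmx -!map_mxM.
    by apply: red11; have := odd_uu g; rewrite (_ : 2 = p%:Z) ?p2 // expr2 -p2 dvdz_mul2l.
  - move=> h; have [g ->] := lift h; rewrite -red_horner_mx !map_trmx -!map_mxM.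
    apply/eqP; rewrite -subr_eq0 -[X in _ - X](oppr_F2 two0) opprK -map_mxD.
    apply/eqP/red11; rewrite [X in (_ %| X)%Z]mxE; apply: dvdz_trans (even_uu g).
    by rewrite expr2 dvdz_mulr.
have QR0 : red (Q *m R) = 0.
  by apply/row_matrixP => i; rewrite row0 -map_row row_mul; case: (rowsQ i).
have QAR0 : red (Q *m A *m R) = 0.
  by apply/row_matrixP => i; rewrite row0 -map_row !row_mul; case: (rowsQ i).
have QA0 : red Q *m red A = 0.
  rewrite -map_mxM -bipA mulmxDr !mulmxA map_mxD !map_mxM -map_mxM QR0.
  by rewrite !mul0mx add0r -!map_mxM map_mxM QAR0 mul0mx.
have QA0' : red Q *m red A = 0 *: red Q by rewrite QA0 scale0r.
have unit0 (c : int) : c = 1 \/ c = -1 -> c%:~R *: red Q = 0 -> red Q = 0.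
  by case=> ->; rewrite ?rmorphN1 ?scaleN1r ?scale1r // => /eqP; rewrite oppr_eq0 => /eqP.
(* As [Q A] vanishes modulo [p], the relation [Q chi(A) = 0] or [Q chi'(A) = 0] reduces to [Q] times
   the constant term of [chi] or [chi'], which is [phi(0)]. *)
apply: (unit0 _ phi0); case: charA => eA.
  have := Cayley_Hamilton A; move/(congr1 (fun X => red (Q *m X))).
  rewrite map_mxM red_horner_mx (horner_mx_eigen _ QA0') mulmx0 map_mx0.
  by rewrite horner_coef0 coef_map eA /= coef0_comp_X2.
have := red_kill; rewrite map_mxM red_horner_mx (horner_mx_eigen _ QA0').
rewrite horner_coef0 coef_map eA /= derivM derivX mul1r coefD coefXM /= addr0.
by rewrite coef0_comp_X2.
Qed.

End PrimeLevel.

End Bipartite.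

(** * Integrality of the orthogonal matrix *)

Section Level.
Variables (m n k : nat) (A : 'M[int]_n.+1) (R : 'M[int]_(n.+1, k.+1)) (N : 'M[int]_k.+1).
Let phi := char_poly N.
Hypotheses (symA : A^T = A) (RR : R^T *m R = 1%:M).
Hypothesis bipA : R *m R^T *m A + A *m (R *m R^T) = A.
Hypothesis defN : N = R^T *m (A *m A) *m R.
Hypothesis charA : char_poly A = phi \Po 'X^2 \/ char_poly A = 'X * (phi \Po 'X^2).
Hypothesis phi0 : phi`_0 = 1 \/ phi`_0 = -1.
Hypothesis sqfree : forall p, prime p -> ~~ (p%:Z ^+ 2 %| \det (horner_mx N phi^`()))%Z.

Local Notation ratmx := (map_mx (intr : int -> rat)).

Lemma ratmx_inj m1 m2 (X Y : 'M[int]_(m1, m2)) : ratmx X = ratmx Y -> X = Y.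
Proof.
by move=> /matrixP e; apply/matrixP => i j; have := e i j; rewrite !mxE => /intr_inj.
Qed.

Lemma orthogonal_conj_integral (Q : 'M[rat]_(m.+1, n.+1)) (B : 'M[int]_m.+1) :
  Q *m Q^T = 1%:M -> Q *m ratmx A = ratmx B *m Q -> exists Z, Q = ratmx Z.
Proof.
move=> QQ QA.
pose P l := (0 < l)%N && [forall i, forall j, l%:R * Q i j \is a Num.int].
have PP l : P l -> exists2 Z, (0 < l)%N & l%:R *: Q = ratmx Z.
  case/andP=> l0 /forallP intQ; exists (\matrix_(i, j) Num.floor (l%:R * Q i j)) => //.
  apply/matrixP => i j; rewrite !mxE floorK //.
  by have /forallP := intQ i; apply.
have exP : exists l, P l.
  exists (\prod_i \prod_j `|denq (Q i j)|)%N; apply/andP; split.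
    rewrite prodn_gt0 // => i; rewrite prodn_gt0 // => j.
    by rewrite absz_gt0 denq_neq0.
  apply/forallP => i; apply/forallP => j.
  rewrite (bigD1 i) //= (bigD1 j) //= -mulnA mulnC natrM -mulrA.
  rewrite rpredM // ?rpred_nat // natr_absz gtr0_norm ?denq_gt0 //.
  by rewrite mulrC -numqE rpred_int.
case: (ex_minnP exP) => l /PP[Z l0 lQ] lmin.
have [l1 | l1] := eqVneq l 1%N.
  by exists Z; rewrite -lQ l1 scale1r.
have p_pr : prime (pdiv l) by rewrite pdiv_prime // ltn_neqAle eq_sym l1.
have /dvdnP[c lc] := pdiv_dvd l; move: (pdiv l) p_pr lc => p p_pr lc.
have ZA : Z *m A = B *m Z.
  apply: ratmx_inj; rewrite !map_mxM -lQ -scalemxAl QA -scalemxAr //.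
have ZZ : Z *m Z^T = (l%:Z ^+ 2)%:M.
  apply: ratmx_inj; rewrite map_mxM -map_trmx -lQ linearZ /= -scalemxAl -scalemxAr.
  by rewrite QQ scalerA scalemx1 map_scalar_mx rmorphXn expr2.
(* Integrality of [B] enters here: [Z f(A) Z^T = f(B) Z Z^T = l^2 f(B)], and [p] divides [l]. *)
have ZfZ f : exists D, Z *m horner_mx A f *m Z^T = p%:Z ^+ 2 *: D.
  exists (c%:Z ^+ 2 *: horner_mx B f).
  rewrite (horner_mx_intertwine f ZA) -mulmxA ZZ mul_mx_scalar scalerA.
  by rewrite lc PoszM exprMn mulrC.
have /eqP/(red_eq0P p_pr)[Z' eZ] :=
  red_level symA RR bipA defN p_pr (sqfree p_pr) charA phi0 ZA ZfZ.
have c0 : (0 < c)%N by move: l0; rewrite lc muln_gt0 => /andP[].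
have p0 : p%:R != 0 :> rat by rewrite pnatr_eq0 -lt0n prime_gt0.
have cQ : c%:R *: Q = ratmx Z'.
  apply: (scalerI p0); rewrite scalerA -natrM mulnC -lc lQ eZ.
  by rewrite map_mxZ.
have /lmin : P c.
  apply/andP; split=> //; apply/forallP => i; apply/forallP => j.
  by have /matrixP/(_ i j) := cQ; rewrite !mxE => ->; exact: rpred_int.
by rewrite lc -[leqRHS]muln1 leq_pmul2l // leqNgt prime_gt1.
Qed.

End Level.

(** In the orthonormal basis given by [R] and [R2] the matrix is block anti-diagonal, and
    [det_block_scalar] applies with [d = X]. Powers of [X] on both sides avoid fixing which block is
    larger. *)
Lemma char_poly_bipartite n k k2 (A : 'M[int]_n) (R : 'M[int]_(n, k))
    (R2 : 'M[int]_(n, k2)) :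
  (k + k2)%N = n -> R *m R^T + R2 *m R2^T = 1%:M ->
  R^T *m A *m R = 0 -> R2^T *m A *m R2 = 0 ->
  'X ^+ k * char_poly A
    = 'X ^+ k2 * (char_poly (R^T *m (A *m A) *m R) \Po 'X^2).
Proof.
move=> kn RR RAR RAR2.
pose P := row_mx R R2.
have PP : P *m P^T = 1%:M by rewrite tr_row_mx mul_row_col.
have PP' : P^T *m P = 1%:M by move: P PP; rewrite kn => P; exact: mulmx1C.
rewrite -(@char_poly_conj _ _ _ P^T P A) ?PP //; last first.
pose M := R^T *m A *m R2; pose M' := R2^T *m A *m R.
have PAP : P^T *m A *m P = block_mx 0 M M' 0.
  by rewrite tr_row_mx mul_col_mx mul_col_row RAR RAR2.
have MM : R^T *m (A *m A) *m R = M *m M'.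
  rewrite /M /M' !mulmxA -(mulmxA _ R2) -[R2 *m _](addKr (R *m R^T)) RR.
  by rewrite mulmxDr mulmx1 mulmxN !mulmxA RAR !mul0mx oppr0 add0r.
have -> : char_poly (P^T *m A *m P)
    = \det (block_mx 'X%:M (- map_mx polyC M) (- map_mx polyC M') 'X%:M).
  rewrite PAP /char_poly /char_poly_mx map_block_mx scalar_mx_block opp_block_mx.
  by rewrite add_block_mx !map_mx0 !oppr0 !addr0 !add0r.
rewrite det_block_scalar mulmxN mulNmx opprK -map_mxM -MM.
congr (_ * _); rewrite /char_poly -(det_map_mx (comp_poly 'X^2)); congr (\det _).
rewrite /char_poly_mx map_mxB map_scalar_mx /= comp_polyX; congr (_ - _).
by apply/matrixP => i j; rewrite !mxE comp_polyC.
Qed.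

(** * Discriminants *)

Section ClosedField.
Variable F : closedFieldType.

Lemma monic_croots (p : {poly F}) : p \is monic -> exists s, p = \prod_(z <- s) ('X - z%:P).
Proof.
move=> mp; have [s e] := closed_field_poly_normal p.
by exists s; rewrite e (monicP mp) scale1r.
Qed.

(** Both sides are multiplicative in [g], which splits; for a factor [X - a] the claim is
    [char_poly N] evaluated at [a], up to a common sign. *)
Lemma det_horner_mx n (N : 'M[F]_n.+1) s g : char_poly N = \prod_(z <- s) ('X - z%:P) ->
  \det (horner_mx N g) = \prod_(z <- s) g.[z].
Proof.
move=> charN; have sz : size s = n.+1.
  by apply/succn_inj; rewrite -(size_char_poly N) charN size_prod_XsubC.
have [t] := closed_field_poly_normal g; move: (lead_coef g) => c ->.
elim: t => [|a t IHt].
  rewrite big_nil alg_polyC horner_mx_C det_scalar.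
  under eq_bigr do rewrite hornerC.
  by rewrite big_const_seq count_predT sz iter_mulr_1.
rewrite big_cons scalerAr rmorphM /= det_mulmx IHt.
under [RHS]eq_bigr do rewrite hornerM.
rewrite big_split /=; congr (_ * _).
rewrite rmorphB /= horner_mx_X horner_mx_C.
have charNa : \det (a%:M - N) = \prod_(z <- s) (a - z).
  have -> : a%:M - N = map_mx (horner_eval a) (char_poly_mx N).
    by apply/matrixP => i j; rewrite !mxE /horner_eval !hornerE hornerMn hornerX.
  rewrite det_map_mx -/(char_poly N) charN.
  rewrite -[LHS]/((\prod_(z <- s) ('X - z%:P)).[a]) horner_prod.
  by apply: eq_bigr => z _; rewrite !hornerE.
rewrite -opprB -scaleN1r detZ charNa -sz -[in LHS]iter_mulr_1 -(count_predT s) -big_const_seq.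
by rewrite -big_split; apply: eq_bigr => z _; rewrite /= !hornerE mulN1r opprB.
Qed.

Lemma deriv_prod_XsubC (s : seq F) (j : 'I_(size s)) :
  (\prod_(z <- s) ('X - z%:P))^`().[s`_j] = \prod_(i < size s | i != j) (s`_j - s`_i).
Proof.
rewrite (big_nth 0) big_mkord (bigD1 j) //= derivM derivXsubC mul1r !hornerE.
rewrite subrr mul0r addr0 horner_prod; apply: eq_bigr => i _.
by rewrite !hornerE.
Qed.

End ClosedField.

(** Each pair of roots occurs twice in the product of the [p'(z)], with opposite signs; squaring
    removes the resulting sign. *)
Lemma discr_sqr (s : seq algC) (p := \prod_(z <- s) ('X - z%:P)) :
  discr p ^+ 2 = (\prod_(z <- s) p^`().[z]) ^+ 2.
Proof.
have eroots : perm_eq (croots p) s.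
  rewrite /croots; case: closed_field_poly_normal => /= r.
  rewrite (monicP (monic_prod_XsubC _ _ _)) scale1r => e.
  by apply: prod_XsubC_eq.
rewrite -(perm_big _ eroots) /= /discr; set r := croots p in eroots *.
have -> : p = \prod_(z <- r) ('X - z%:P) by rewrite (perm_big _ eroots).
rewrite [in RHS](big_nth 0) big_mkord.
under [X in _ = X ^+ 2]eq_bigr do rewrite deriv_prod_XsubC.
pose a (j i : 'I_(size r)) := (r`_j - r`_i) ^+ 2.
have aC i j : a i j = a j i by rewrite /a -[LHS]sqrrN opprB.
rewrite expr2 -[in RHS]prodrXl.
have -> : \prod_(j < size r) (\prod_(i < size r | i != j) (r`_j - r`_i)) ^+ 2
    = \prod_(j < size r) (\prod_(i < size r | (i < j)%N) a j i)
      * \prod_(j < size r) (\prod_(i < size r | (j < i)%N) a j i).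
  rewrite -big_split; apply: eq_bigr => j _; rewrite -prodrXl /=.
  rewrite (bigID (fun i : 'I__ => (i < j)%N)) /=; congr (_ * _).
    by apply: eq_bigl => i; rewrite -val_eqE /=; case: ltngtP.
  by apply: eq_bigl => i; rewrite -val_eqE /=; case: ltngtP.
congr (_ * _); rewrite [RHS](exchange_big_dep xpredT) //=.
by apply: eq_bigr => i _; apply: eq_bigr => j _; exact: aC.
Qed.

Lemma coef0_prod_XsubC (F : comNzRingType) (s : seq F) :
  (\prod_(z <- s) ('X - z%:P))`_0 = \prod_(z <- s) (- z).
Proof.
rewrite -horner_coef0 horner_prod; apply: eq_bigr => z _.
by rewrite !hornerE.
Qed.

(** The two square roots of a root [z] of [phi] contribute [-4 z phi'(z)^2] in the even case and
    [4 z^2 phi'(z)^2] in the odd one, where the root [0] adds [phi(0)]. As [phi(0)] has square 1,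
    the product of the [z] disappears after squaring. *)
Lemma discr_comp_X2 (s : seq algC) (phi := \prod_(z <- s) ('X - z%:P)) (p : {poly algC}) :
  p = phi \Po 'X^2 \/ p = 'X * (phi \Po 'X^2) -> phi`_0 ^+ 2 = 1 ->
  discr p ^+ 2 = 16%:R ^+ size s * (\prod_(z <- s) phi^`().[z]) ^+ 4.
Proof.
move=> ep phi0.
have phi_s z : z \in s -> phi.[z] = 0 by rewrite -root_prod_XsubC => /rootP.
have prod_s : (\prod_(z <- s) z) ^+ 2 = 1.
  rewrite -[RHS]phi0 coef0_prod_XsubC -!prodrXl; apply: eq_bigr => z _.
  by rewrite sqrrN.
have sqX (z : algC) : 'X^2 - z%:P = ('X - (sqrtC z)%:P) * ('X - (- sqrtC z)%:P).
  rewrite -{1}(sqrtCK z) rmorphXn rmorphN /=; ring.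
have phi_factor : phi \Po 'X^2
    = \prod_(x <- map sqrtC s ++ map (fun z => - sqrtC z) s) ('X - x%:P).
  rewrite /phi big_cat !big_map /= -big_split rmorph_prod; apply: eq_bigr => z _ /=.
  by rewrite comp_polyB comp_polyX comp_polyC sqX.
have dphi2 x : (phi \Po 'X^2)^`().[x] = 2 * x * phi^`().[x ^+ 2].
  rewrite deriv_comp derivXn /= expr1 hornerM horner_comp hornerXn hornerMn hornerX.
  by rewrite -[x *+ 2]mulr_natl mulrC.
have big_const (c : algC) : \prod_(z <- s) c = c ^+ size s.
  by rewrite big_const_seq count_predT iter_mulr_1.
case: ep => ->.
  rewrite phi_factor discr_sqr -phi_factor big_cat !big_map /= -big_split /=.
  have -> : \prod_(z <- s) ((phi \Po 'X^2)^`().[sqrtC z] * (phi \Po 'X^2)^`().[- sqrtC z])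
    = \prod_(z <- s) (- 4%:R) * \prod_(z <- s) z * (\prod_(z <- s) phi^`().[z]) ^+ 2.
    rewrite -prodrXl -!big_split; apply: eq_bigr => z _ /=.
    rewrite !dphi2 sqrrN sqrtCK; set w := phi^`().[z].
    by rewrite -[X in _ * X * w ^+ 2](sqrtCK z); ring.
  rewrite !exprMn prod_s mulr1 big_const exprAC; congr (_ ^+ _ * _); ring.
have factor : 'X * (phi \Po 'X^2)
    = \prod_(x <- 0 :: map sqrtC s ++ map (fun z => - sqrtC z) s) ('X - x%:P).
  by rewrite big_cons -phi_factor subr0.
rewrite factor discr_sqr -factor big_cons big_cat !big_map /= -big_split /=.
have dX2 x : ('X * (phi \Po 'X^2))^`().[x] = phi.[x ^+ 2] + 2 * x ^+ 2 * phi^`().[x ^+ 2].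
  rewrite derivM derivX mul1r hornerD horner_comp hornerXn hornerM hornerX dphi2; ring.
rewrite dX2 expr0n mulr0 mul0r addr0 horner_coef0.
have -> : \prod_(z <- s) (('X * (phi \Po 'X^2))^`().[sqrtC z]
      * ('X * (phi \Po 'X^2))^`().[- sqrtC z])
  = \prod_(z <- s) 4%:R * (\prod_(z <- s) z) ^+ 2 * (\prod_(z <- s) phi^`().[z]) ^+ 2.
  rewrite -!prodrXl -!big_split !big_seq; apply: eq_bigr => z zs /=.
  by rewrite !dX2 sqrrN sqrtCK phi_s //; ring.
rewrite !exprMn phi0 prod_s. rewrite !mul1r mulr1 big_const exprAC; congr (_ ^+ _ * _); ring.
Qed.

(** * Walk counts and the orthogonal matrix *)

Lemma size_det_linear (R : nzRingType) n (M : 'M[{poly R}]_n) :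
  (forall i j, (size (M i j) <= 2)%N) -> (size (\det M) <= n.+1)%N.
Proof.
move=> sM; rewrite /determinant; apply: leq_trans (size_sum _ _ _) _.
apply/bigmax_leqP => s _; rewrite size_Msign.
apply: leq_trans (size_poly_prod_leq _ _) _; rewrite card_ord leq_subLR.
apply: leq_trans (_ : (\sum_(i < n) 2).+1 <= _)%N.
  by rewrite ltnS; apply: leq_sum => i _; exact: sM.
by rewrite sum_nat_const card_ord; lia.
Qed.

Section RowGram.
Variable n : nat.
Implicit Types a b : 'M[rat]_n.

Lemma gram_eq0 m (V : 'M[rat]_(m, n)) : V *m V^T = 0 -> V = 0.
Proof.
move=> VV; apply/matrixP => i j; rewrite [RHS]mxE.
have /matrixP/(_ i i) := VV; rewrite !mxE => /eqP.
rewrite psumr_eq0 => [|l _]; last by rewrite !mxE -expr2 sqr_ge0.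
by move=> /allP/(_ j (mem_index_enum _)); rewrite /= !mxE mulf_eq0 orbb => /eqP.
Qed.

Lemma gram_unit r (X : 'M[rat]_(r, n)) : row_free X -> X *m X^T \in unitmx.
Proof.
move=> freeX; rewrite -row_free_unit; apply: inj_row_free => v vXX.
have vX : v *m X = 0.
  by apply: gram_eq0; rewrite trmx_mul mulmxA -(mulmxA v) vXX mul0mx.
by apply: (row_free_inj freeX); rewrite /= vX mul0mx.
Qed.

(** [Q^T = X^-1 Y] is forced; the equality of Gram matrices makes it orthogonal, and the equality
    twisted by [a] and [b] makes it intertwine them. *)
Lemma orthogonal_of_gram a b (X Y : 'M[rat]_n) : X \in unitmx ->
  X *m X^T = Y *m Y^T -> X *m a *m X^T = Y *m b *m Y^T ->
  exists Q : 'M_n, [/\ Q *m Q^T = 1%:M, Q *m a = b *m Q & X *m Q^T = Y].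
Proof.
move=> Xu XX XaX; exists (Y^T *m (invmx X)^T).
have XTu : X^T \in unitmx by rewrite unitmx_tr.
have QT : (Y^T *m (invmx X)^T)^T = invmx X *m Y by rewrite trmx_mul !trmxK.
have QQ : (invmx X *m Y) *m (Y^T *m (invmx X)^T) = 1%:M.
  by rewrite mulmxA -(mulmxA _ Y) -XX trmx_inv !mulmxA mulVmx // mul1mx mulmxV.
have aQ : (invmx X *m Y) *m b *m (Y^T *m (invmx X)^T) = a.
  rewrite mulmxA -!(mulmxA (invmx X)) -XaX trmx_inv !mulmxA mulVmx // mul1mx.
  by rewrite mulmxK.
rewrite QT; split; first exact: mulmx1C.
  by rewrite -{1}aQ !mulmxA -(mulmxA _ (invmx X) Y) (mulmx1C QQ) mul1mx.
by rewrite mulKVmx.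
Qed.

End RowGram.

(** With [x] and [y] spanning the complements of the row spaces,
    [det (X;x)^2 = det (X X^T) |x|^2] and likewise for [Y]; so [|x|] and [|y|] have
    rational ratio, and [y] can be rescaled to [|y| = |x|]. *)
Lemma orthogonal_of_gram_corank1 r n (a b : 'M[rat]_n) (X Y : 'M[rat]_(r, n)) :
  n = (r + 1)%N -> a^T = a -> b^T = b -> \tr a = \tr b -> row_free X ->
  (X *m a <= X)%MS -> (Y *m b <= Y)%MS ->
  X *m X^T = Y *m Y^T -> X *m a *m X^T = Y *m b *m Y^T ->
  exists Q : 'M_n, [/\ Q *m Q^T = 1%:M, Q *m a = b *m Q & X *m Q^T = Y].
Proof.
move=> en; subst n => syma symb tr_ab freeX /submxP[D Xa] /submxP[D' Yb] XX XaX.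
have G := gram_unit freeX.
have freeY : row_free Y.
  apply: inj_row_free => v vY; apply: (row_free_inj (_ : row_free (X *m X^T))).
    by rewrite row_free_unit.
  by rewrite /= XX mulmxA vY !mul0mx.
(* [D (X X^T) = X a X^T] determines [D], as the Gram matrix is invertible. *)
have eD : D' = D.
  apply: (can_inj (mulmxK G)); rewrite {1}XX mulmxA -Yb -XaX Xa mulmxA //.
rewrite {D'}eD in Yb.
have perp (c : 'M_(r + 1)) (Z : 'M[rat]_(r, r + 1)) : c^T = c -> row_free Z ->
    Z *m c = D *m Z ->
    exists2 x : 'rV_(r + 1), x *m Z^T = 0 /\ x != 0 & exists l, x *m c = l *: x.
  move=> symc freeZ Zc; have rk : \rank (kermx Z^T) = 1%N.
    by rewrite mxrank_ker mxrank_tr (eqP freeZ) addKn.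
  have /rowV0Pn[x xZ x0] : kermx Z^T != 0 by rewrite -mxrank_eq0 rk.
  move/sub_kermxP: (xZ) => xZ0; exists x => //; apply/sub_rVP.
  have xcZ : (x *m c <= kermx Z^T)%MS.
    apply/sub_kermxP; rewrite -mulmxA -{1}symc -trmx_mul Zc trmx_mul mulmxA xZ0.
    exact: mul0mx.
  apply: submx_trans xcZ _.
  by rewrite -(geq_leqif (mxrank_leqif_sup xZ)) rk rank_rV x0.
have [x [xX x0] [l xa]] := perp a X syma freeX Xa.
have [y [yY y0] [l' yb]] := perp b Y symb freeY Yb.
have gram (Z : 'M[rat]_(r, r + 1)) z : z *m Z^T = 0 ->
    col_mx Z z *m (col_mx Z z)^T = block_mx (Z *m Z^T) 0 0 (z *m z^T).
  move=> zZ; rewrite tr_col_mx mul_col_row zZ; congr block_mx.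
  by apply: trmx_inj; rewrite trmx_mul trmxK zZ trmx0.
have det_gram (Z : 'M[rat]_(r, r + 1)) z : z *m Z^T = 0 ->
    \det (col_mx Z z) ^+ 2 = \det (Z *m Z^T) * (z *m z^T) 0 0.
  by move=> zZ; rewrite expr2 -{2}det_tr -det_mulmx gram // det_ublock det_mx11.
have norm0 (z : 'rV[rat]_(r + 1)) : z != 0 -> (z *m z^T) 0 0 != 0.
  apply: contraNneq => zz; apply/eqP/gram_eq0/matrixP => i j.
  by rewrite !ord1 zz mxE.
have detG : \det (X *m X^T) != 0 by rewrite -unitfE -unitmxE.
have dX : \det (col_mx X x) != 0.
  by rewrite -sqrf_eq0 det_gram // mulf_neq0 ?norm0.
have dY : \det (col_mx Y y) != 0.
  by rewrite -sqrf_eq0 det_gram // mulf_neq0 ?norm0 -?XX.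
pose rho := \det (col_mx X x) / \det (col_mx Y y).
have rho0 : rho != 0 by rewrite mulf_neq0 ?invr_eq0.
pose y' := rho *: y.
have y'Y : y' *m Y^T = 0 by rewrite -scalemxAl yY scaler0.
have xxyy : x *m x^T = y' *m y'^T.
  apply/matrixP => i j; rewrite !ord1 /y' linearZ /= -scalemxAl -scalemxAr scalerA.
  rewrite [RHS]mxE -expr2; apply: (mulfI detG).
  rewrite mulrCA {2}XX -!det_gram // /rho expr_div_n divfK // expf_neq0 //.
have dY' : \det (col_mx Y y') != 0.
  by rewrite -sqrf_eq0 det_gram // mulf_neq0 ?norm0 -?XX // scaler_eq0 negb_or rho0.
have y'b : y' *m b = l' *: y' by rewrite -scalemxAl yb !scalerA mulrC.
have act (c : 'M_(r + 1)) (Z : 'M[rat]_(r, r + 1)) z t : Z *m c = D *m Z ->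
   z *m c = t *: z -> col_mx Z z *m c = block_mx D 0 0 t%:M *m col_mx Z z.
  move=> Zc zc; rewrite mul_col_mx mul_block_col !mul0mx addr0 add0r Zc zc.
  by rewrite mul_scalar_mx.
have trace (c : 'M_(r + 1)) (Z : 'M[rat]_(r, r + 1)) z t : \det (col_mx Z z) != 0 ->
   Z *m c = D *m Z -> z *m c = t *: z -> \tr c = \tr D + t.
  rewrite -unitfE -unitmxE => Pu Zc zc.
  rewrite -[c](mulKmx Pu) mxtrace_mulC (act _ _ _ _ _ Zc zc) mulmxK //.
  by rewrite mxtrace_block mxtrace_scalar mulr1n.
(* Both traces are that of [D] plus the eigenvalue on the complementary line. *)
have ll : l = l'.
  apply: (addrI (\tr D)); rewrite -(@trace a X x l) // tr_ab; exact: (@trace b Y y').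
have [] := @orthogonal_of_gram _ a b (col_mx X x) (col_mx Y y').
- by rewrite unitmxE unitfE.
- by rewrite !gram // XX xxyy.
- rewrite (act _ _ _ _ _ Xa xa) (act _ _ _ _ _ Yb y'b) ll -!mulmxA !gram //.
  by rewrite XX xxyy.
move=> Q [QQ Qa XQ]; exists Q; split=> //.
by move: XQ; rewrite mul_col_mx => /eq_col_mx[].
Qed.

Section WalkCounts.
Variable n : nat.
Local Notation ones := (const_mx 1 : 'cV[int]_n.+1).
Local Notation onesX := (const_mx 1 : 'cV[{poly int}]_n.+1).
Implicit Types A B : 'M[int]_n.+1.

Definition walk_count A k : int := (ones^T *m (A ^+ k *m ones)) 0 0.

Lemma const1_mxE (R : pzSemiRingType) m :
  const_mx 1 *m (const_mx 1 : 'cV[R]_m)^T = const_mx 1 :> 'M_m.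
Proof. by apply/matrixP => i j; rewrite !mxE big_ord1 !mxE mulr1. Qed.

(** Substituting [-X - 1] turns [X I - (J - I - A)] into [-(X I - A + J)], a rank one perturbation
    of the characteristic matrix of [A]. *)
Lemma char_poly_complement A :
  char_poly (const_mx 1 - 1%:M - A) \Po (- 'X - 1)
    = (-1) ^+ n.+1 * \det (char_poly_mx A + const_mx 1).
Proof.
rewrite /char_poly -detZ -(det_map_mx (comp_poly (- 'X - 1))); congr (\det _).
apply/matrixP => i j; rewrite !mxE /=; case: (i == j).
  by rewrite !mulr1n comp_polyB comp_polyX comp_polyC !rmorphB rmorph1 /=; ring.
by rewrite !mulr0n comp_polyB comp_poly0 comp_polyC !rmorphB rmorph1 rmorph0 /=; ring.
Qed.

Lemma det_add_ones A : \det (char_poly_mx A + const_mx 1)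
  = char_poly A + (onesX^T *m \adj (char_poly_mx A) *m onesX) 0 0.
Proof.
set M := char_poly_mx A; set chi := char_poly A; set u := onesX.
have chi0 : chi != 0 := monic_neq0 (char_poly_monic A).
have detM : \det M = chi by [].
have := det_scalar_add_col_row chi (\adj M *m u) u^T.
have -> : chi%:M + \adj M *m u *m u^T = \adj M *m (M + const_mx 1).
  by rewrite mulmxDr mul_adj_mx detM -mulmxA const1_mxE.
rewrite det_mulmx mulrA -{1}detM -det_mulmx mul_mx_adj det_scalar detM.
by move/(mulfI (expf_neq0 _ chi0)); rewrite mulmxA.
Qed.

(** The generating polynomial [e^T A^k adj(X - A) e]: its degree is at most [n], which
    lets [gen_rec] determine [walk_count A k] from [gen A k]. *)
Let gen A k : {poly int} := (onesX^T *m map_mx polyC (A ^+ k)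
   *m \adj (char_poly_mx A) *m onesX) 0 0.

Let size_gen A k : (size (gen A k) <= n.+1)%N.
Proof.
rewrite /gen mxE; apply: leq_trans (size_sum _ _ _) _; apply/bigmax_leqP => i _.
rewrite [const_mx _ _ _]mxE mulr1 mxE; apply: leq_trans (size_sum _ _ _) _.
apply/bigmax_leqP => j _.
have -> : (onesX^T *m map_mx polyC (A ^+ k)) 0 j = (\sum_i (A ^+ k) i j)%:P.
  by rewrite !mxE rmorph_sum /=; apply: eq_bigr => l _; rewrite !mxE mul1r.
rewrite mul_polyC; apply: leq_trans (size_scale_leq _ _) _.
rewrite mxE /cofactor size_Msign; apply: size_det_linear => a b.
rewrite !mxE; case: eqP => _; rewrite ?mulr1n ?mulr0n ?sub0r ?size_polyN.
  by rewrite size_XsubC.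
by apply: leq_trans (size_polyC_leq1 _) _.
Qed.

Let coef_gen A k : (gen A k)`_n.+1 = 0.
Proof. exact/nth_default/size_gen. Qed.

Let gen_rec A k : gen A k.+1 = 'X * gen A k - char_poly A * (walk_count A k)%:P.
Proof.
set u := onesX; pose M := char_poly_mx A.
have AM : map_mx polyC A *m \adj M = 'X *: \adj M - (char_poly A)%:M.
  by rewrite -(mul_mx_adj M) {2}/M /char_poly_mx mulmxBl mul_scalar_mx subKr.
have rec : u^T *m map_mx polyC (A ^+ k.+1) *m \adj M *m u
    = 'X *: (u^T *m map_mx polyC (A ^+ k) *m \adj M *m u)
      + (- char_poly A) *: map_mx polyC (ones^T *m (A ^+ k *m ones)).
  have eu : u = map_mx polyC ones by apply/matrixP => i j; rewrite !mxE.
  rewrite exprSr -mulmxE map_mxM (mulmxA u^T) -(mulmxA _ (map_mx polyC A)) AM.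
  rewrite mulmxBr mulmxBl mul_mx_scalar -scalemxAr -!scalemxAl scaleNr.
  by congr (_ - _ *: _); rewrite !map_mxM -map_trmx -eu mulmxA.
rewrite /gen rec [LHS]mxE [X in X + _]mxE [X in _ + X]mxE mulNr.
by congr (_ - _ * _); rewrite mxE.
Qed.

(** The complements give [gen A 0 = gen B 0]. If [gen A j = gen B j], the next two polynomials
    differ by the monic [chi] of degree [n.+1] times the difference of the walk counts; as their
    degrees are at most [n], that difference is zero. *)
Lemma walk_count_eq A B : char_poly A = char_poly B ->
  char_poly (const_mx 1 - 1%:M - A) = char_poly (const_mx 1 - 1%:M - B) ->
  walk_count A =1 walk_count B.
Proof.
move=> eAB eJ k.
have [g [gcoef grec g0]] : exists g : 'M[int]_n.+1 -> nat -> {poly int},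
    [/\ forall M k, (g M k)`_n.+1 = 0,
        forall M k, g M k.+1 = 'X * g M k - char_poly M * (walk_count M k)%:P
      & g A 0 = g B 0].
  exists gen; split; [exact: coef_gen | exact: gen_rec |].
  have := char_poly_complement A; rewrite eJ char_poly_complement => /esym.
  have s0 : (-1) ^+ n.+1 != 0 :> {poly int} by rewrite signr_eq0.
  move/(mulfI s0); rewrite !det_add_ones eAB => /addrI.
  by rewrite /gen !expr0 !map_mx1 !mulmx1.
have step j : g A j = g B j -> walk_count A j = walk_count B j.
  move=> gj; apply/eqP; rewrite -subr_eq0; apply/eqP; set c := _ - _.
  have : char_poly B * c%:P = g B j.+1 - g A j.+1.
    by rewrite !grec eAB gj /c rmorphB /=; ring.
  move/(congr1 (fun p : {poly int} => p`_n.+1)); rewrite coefMC coefB.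
  have -> : (char_poly B)`_n.+1 = 1.
    by have /monicP := char_poly_monic B; rewrite lead_coefE size_char_poly.
  by rewrite (gcoef B j.+1) (gcoef A j.+1) subr0 mul1r.
apply: (step); elim: k => [//|k IHk].
by rewrite !grec eAB IHk (step _ IHk).
Qed.

Definition walk_matrix A : 'M[int]_n.+1 := \matrix_(i, j) (A ^+ j *m ones) i 0.

Lemma walk_matrix_gram A k : A^T = A -> (walk_matrix A)^T *m A ^+ k *m walk_matrix A
  = \matrix_(i, j) walk_count A (i + k + j).
Proof.
move=> symA; have symAk j : (A ^+ j)^T = A ^+ j.
  elim: j => [|j IHj]; first by rewrite expr0 trmx1.
  by rewrite exprS -mulmxE trmx_mul IHj symA !mulmxE -exprS -exprSr.
have colW j : col j (walk_matrix A) = A ^+ j *m ones.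
  by apply/matrixP => a b; rewrite [b]ord1 [LHS]mxE [LHS]mxE.
apply/matrixP => i j; rewrite [RHS]mxE /walk_count.
transitivity ((row i (walk_matrix A)^T *m A ^+ k *m col j (walk_matrix A)) 0 0).
  rewrite -row_mul [LHS]mxE [RHS]mxE; apply: eq_bigr => l _.
  by congr (_ * _); rewrite [RHS]mxE.
rewrite -tr_col !colW trmx_mul symAk -!mulmxA; congr ((_ *m _) 0 0).
by rewrite !mulmxA !mulmxE -!exprD.
Qed.

Local Notation ratmx := (map_mx (intr : int -> rat)).

(** The rows [e^T A^j] with [j <= n] span the whole Krylov space, the minimal polynomial having
    degree at most [n.+1]. *)
Lemma walk_matrix_stable A : A^T = A ->
  ((ratmx (walk_matrix A))^T *m ratmx A <= (ratmx (walk_matrix A))^T)%MS.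
Proof.
move=> symA; set a := ratmx A; set W := (ratmx _)^T; pose u : 'rV[rat]_n.+1 := const_mx 1.
have rowW j : row j W = u *m a ^+ j.
  apply: trmx_inj; rewrite tr_row trmxK trmx_mul.
  have -> : (a ^+ j)^T = ratmx (A ^+ j).
    by rewrite -[a]horner_mx_X -rmorphXn sym_horner_mx ?rmorphXn /= ?horner_mx_X ?rmorphXn //
      /a map_trmx symA.
  apply/matrixP => i l; rewrite !mxE rmorph_sum ord1; apply: eq_bigr => t _.
  by rewrite !mxE rmorphM rmorph1.
set d := degree_mxminpoly a.
have dn : (d <= n.+1)%N.
  rewrite -ltnS -size_mxminpoly -(size_char_poly a) dvdp_leq ?mxminpoly_dvd_char //.
  exact/monic_neq0/char_poly_monic.
have XW : (powers_mx a d *m lin_mul_row u <= W)%MS.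
  apply/row_subP => i; rewrite row_mul rowK mul_vec_lin_row.
  by rewrite -(rowW (widen_ord dn i)) row_sub.
apply/row_subP => i; rewrite row_mul rowW -mulmxA mulmxE -exprSr.
rewrite -[a](horner_mx_X a) -rmorphXn -mul_vec_lin_row.
exact: submx_trans (submxMr _ (horner_mx_mem _ _)) XW.
Qed.

Lemma walk_orthogonal A B (r := \rank (ratmx (walk_matrix A))) :
  A^T = A -> B^T = B -> char_poly A = char_poly B ->
  char_poly (const_mx 1 - 1%:M - A) = char_poly (const_mx 1 - 1%:M - B) ->
  r = n.+1 \/ r.+1 = n.+1 ->
  exists Q : 'M[rat]_n.+1, [/\ Q *m Q^T = 1%:M, Q *m ratmx A = ratmx B *m Q
    & Q *m const_mx 1 = const_mx 1 :> 'cV_n.+1].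
Proof.
move=> symA symB eAB eJ rk; have counts := walk_count_eq eAB eJ.
have gram k : (walk_matrix A)^T *m A ^+ k *m walk_matrix A
    = (walk_matrix B)^T *m B ^+ k *m walk_matrix B.
  by rewrite !walk_matrix_gram //; apply/matrixP => i j; rewrite !mxE counts.
pose X := (ratmx (walk_matrix A))^T; pose Y := (ratmx (walk_matrix B))^T.
have rkX : \rank X = r by rewrite mxrank_tr.
have XX : X *m X^T = Y *m Y^T.
  by have := gram 0%N; rewrite !expr0 !mulmx1 /X /Y !trmxK !map_trmx -!map_mxM => ->.
have XaX : X *m ratmx A *m X^T = Y *m ratmx B *m Y^T.
  by have := gram 1%N; rewrite !expr1 /X /Y !trmxK !map_trmx -!map_mxM => ->.
suff [Q [QQ Qa XQ]] : exists Q : 'M_n.+1,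
    [/\ Q *m Q^T = 1%:M, Q *m ratmx A = ratmx B *m Q & X *m Q^T = Y].
  exists Q; split=> //.
  have col0W (M : 'M[int]_n.+1) : col 0 (ratmx (walk_matrix M)) = const_mx 1.
    apply/matrixP => i j; rewrite [LHS]mxE [LHS]mxE.
    by rewrite [X in X%:~R]mxE expr0 -idmxE mul1mx !mxE.
  have QW : Q *m ratmx (walk_matrix A) = ratmx (walk_matrix B).
    by apply: trmx_inj; rewrite trmx_mul.
  by rewrite -{1}(col0W A) colE mulmxA QW -colE.
case: rk => rk.
  by apply: orthogonal_of_gram; rewrite // -row_free_unit /row_free rkX rk.
have /submxP[L eL] : (row_base X <= X)%MS by rewrite eq_row_base.
have /submxP[H eH] : (X <= row_base X)%MS by rewrite eq_row_base.
pose Z := 1%:M - H *m L.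
have ZX : Z *m X = 0 by rewrite mulmxBl mul1mx -mulmxA -eL -eH subrr.
(* Equal Gram matrices force equal relations between rows: [Z X = 0] gives [Z Y (Z Y)^T = 0], so
   [Z Y = 0]. Hence [L Y] is the counterpart of the row basis [L X]. *)
have LYH : Y = H *m (L *m Y).
  apply/eqP; rewrite -subr_eq0 -[X in X - _]mul1mx mulmxA -mulmxBl -/Z.
  apply/eqP/gram_eq0.
  by rewrite trmx_mul mulmxA -(mulmxA Z) -XX mulmxA ZX !mul0mx.
have [|||||||||Q [QQ Qa XQ]] :=
    @orthogonal_of_gram_corank1 _ _ (ratmx A) (ratmx B) (row_base X) (L *m Y).
- by rewrite rkX addn1 -rk.
- by rewrite map_trmx symA.
- by rewrite map_trmx symB.
- have tr0 (M : 'M[int]_n.+1) : \tr M = - (char_poly M)`_n.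
    by rewrite char_poly_trace // opprK.
  have trQ (M : 'M[int]_n.+1) : \tr (ratmx M) = (\tr M)%:~R.
    by rewrite /mxtrace rmorph_sum; apply: eq_bigr => i _; rewrite mxE.
  by rewrite !trQ !tr0 eAB.
- exact: row_base_free.
- by rewrite eq_row_base eL -mulmxA (submx_trans (submxMl _ _)) ?walk_matrix_stable.
- rewrite -mulmxA (submx_trans (submxMl _ _)) // (submx_trans (walk_matrix_stable symB)) //.
  by rewrite -/Y {1}LYH submxMl.
- by rewrite eL !trmx_mul !mulmxA -(mulmxA L X) XX !mulmxA.
- by rewrite eL !trmx_mul !mulmxA -(mulmxA L X) -(mulmxA L (X *m _)) XaX !mulmxA.
by exists Q; split=> //; rewrite {1}eH -mulmxA XQ -LYH.
Qed.

End WalkCounts.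

(** The discriminant is known only up to sign, so its square is used and fourth powers [m^4 = d^4]
    are compared. *)
Lemma discr_horner_mx k (N : 'M[int]_k.+1) (phi := char_poly N) (p : {poly int}) (m : int) :
  p = phi \Po 'X^2 \/ p = 'X * (phi \Po 'X^2) -> phi`_0 = 1 \/ phi`_0 = -1 ->
  2%:R ^- k.+1 * sqrtC (discr (map_poly intr p)) = m%:~R ->
  `|m| = `|\det (horner_mx N phi^`())|.
Proof.
move=> ep phi0 em; set d := \det _.
have charN : map_poly intr phi = char_poly (map_mx (intr : int -> algC) N).
  exact: map_char_poly.
have [s es] := monic_croots (char_poly_monic (map_mx (intr : int -> algC) N)).
have size_s : size s = k.+1.
  by apply/succn_inj; rewrite -(size_prod_XsubC s id) -es size_char_poly.
have ed : d%:~R = \prod_(z <- s) (map_poly (intr : int -> algC) phi)^`().[z].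
  rewrite -(det_horner_mx _ es) deriv_map -map_horner_mx det_map_mx //.
have ep' : map_poly intr p = (\prod_(z <- s) ('X - z%:P)) \Po 'X^2
    \/ map_poly intr p = 'X * ((\prod_(z <- s) ('X - z%:P)) \Po 'X^2).
  rewrite -es -charN; case: ep => ->; [left|right];
    by rewrite ?rmorphM /= ?map_polyX map_comp_poly map_polyXn.
have s0 : (\prod_(z <- s) ('X - z%:P))`_0 ^+ 2 = 1.
  rewrite -es -charN coef_map /=.
  by case: phi0 => ->; rewrite ?rmorphN1 ?sqrrN expr1n.
have := discr_comp_X2 ep' s0; rewrite -es -charN -ed size_s => disc2.
have two0 : 2%:R ^+ k.+1 != 0 :> algC by rewrite expf_neq0 // pnatr_eq0.
have disc1 : discr (map_poly intr p) = (2%:R ^+ k.+1 * m%:~R) ^+ 2.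
  by rewrite -em mulVKf // sqrtCK.
have : m ^+ 4 = d ^+ 4.
  apply: (@intr_inj algC); rewrite !rmorphXn /=.
  apply: (@mulfI _ (16%:R ^+ k.+1)); first by rewrite expf_neq0 // pnatr_eq0.
  rewrite -disc2 disc1 -exprM exprMn -exprM mulnC exprM; congr (_ ^+ _ * _); ring.
move/(congr1 Num.norm); rewrite !normrX => /eqP.
by rewrite eqrXn2 ?normr_ge0 // => /eqP.
Qed.

(** * Permutation matrices and coordinate selections *)

(** In each row the nonnegative integers [z^2 - z] add up to [1 - 1 = 0], so the entries are 0 or 1;
    orthogonality puts the ones of distinct rows in distinct columns. *)
Lemma orthogonal_stochastic_perm n (Z : 'M[int]_n) : Z *m Z^T = 1%:M ->
  Z *m const_mx 1 = const_mx 1 :> 'cV_n -> exists s : 'S_n, Z = perm_mx s.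
Proof.
move=> ZZ Z1.
have sum1 i : \sum_j Z i j = 1.
  have /matrixP/(_ i 0) := Z1; rewrite !mxE => <-.
  by apply: eq_bigr => j _; rewrite mxE mulr1.
have sum2 i : \sum_j Z i j ^+ 2 = 1.
  have /matrixP/(_ i i) := ZZ; rewrite !mxE eqxx mulr1n => <-.
  by apply: eq_bigr => j _; rewrite mxE expr2.
have Z01 i j : Z i j = 0 \/ Z i j = 1.
  have pos (z : int) : 0 <= z ^+ 2 - z by nia.
  have : \sum_l (Z i l ^+ 2 - Z i l) == 0 by rewrite sumrB sum1 sum2 subrr.
  rewrite psumr_eq0 => [/allP/(_ j (mem_index_enum _))/eqP /=|l _]; last exact: pos.
  by move=> z0; nia.
have [f Zf] : exists f : 'I_n -> 'I_n, forall i j, Z i j = (f i == j)%:R.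
  suff /fin_all_exists[f Zf] i : exists j, forall l, Z i l = (j == l)%:R by exists f.
  have /existsP[j Zj] : [exists j, Z i j != 0].
    apply: contraT; rewrite negb_exists => /forallP Z0; have := sum1 i.
    rewrite big1 // => j _; apply/eqP; have := Z0 j; by rewrite negbK.
  have {}Zj : Z i j = 1 by case: (Z01 i j) Zj => ->.
  exists j => l; case: eqVneq => [<- //|jl].
  have := sum1 i; rewrite (bigD1 j) //= Zj => /(canRL (addKr _)); rewrite addNr.
  move/eqP; rewrite psumr_eq0 => [|t _]; last by case: (Z01 i t) => ->.
  by move/allP/(_ l (mem_index_enum _)); rewrite eq_sym jl => /eqP.
have f_inj : injective f.
  move=> i j fij; apply/eqP; have /matrixP/(_ i j) := ZZ; rewrite !mxE.
  rewrite (bigD1 (f i)) //= big1 => [|l]; last first.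
    by rewrite eq_sym !mxE !Zf => /negPf ->; rewrite mul0r.
  by rewrite mxE !Zf fij eqxx; case: (i == j).
exists (perm f_inj); apply/matrixP => i j; rewrite !mxE permE Zf //.
Qed.

Section Selection.
Variable n : nat.
Implicit Types D : {set 'I_n}.

(** Inclusion of the coordinates in [D], giving access to blocks without reordering the vertices. *)
Definition selection D : 'M[int]_(n, #|D|) := \matrix_(i, j) (i == enum_val j)%:R.

Lemma tr_selection_mul D : (selection D)^T *m selection D = 1%:M.
Proof.
apply/matrixP => i j; rewrite !mxE (bigD1 (enum_val i)) //= big1 => [|l li].
  by rewrite !mxE eqxx mul1r addr0 (inj_eq enum_val_inj).
by rewrite !mxE (negPf li) mul0r.
Qed.

Lemma selection_mul_tr D :
  selection D *m (selection D)^T = \matrix_(i, j) ((i == j) && (i \in D))%:R.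
Proof.
apply/matrixP => i j; rewrite !mxE; have [iD|iD] := boolP (i \in D); last first.
  rewrite andbF big1 // => l _; rewrite !mxE; case: eqP => [il|]; last by rewrite mul0r.
  by rewrite il enum_valP in iD.
rewrite (bigD1 (enum_rank_in iD i)) //= big1 => [|l li].
  by rewrite !mxE enum_rankK_in // eqxx mul1r addr0 andbT eq_sym.
rewrite !mxE; case: eqP => [il|]; last by rewrite mul0r.
by case/eqP: li; apply: enum_val_inj; rewrite enum_rankK_in.
Qed.

Lemma selection_block D (M : 'M[int]_n) :
  (forall i j, i \in D -> j \in D -> M i j = 0) ->
  (selection D)^T *m M *m selection D = 0.
Proof.
move=> M0; apply/matrixP => i j; rewrite !mxE big1 // => l _; rewrite !mxE.
case: (l =P enum_val j) => [->|]; last by rewrite mulr0.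
rewrite mulr1 big1 // => t _; rewrite !mxE; case: eqP => [->|]; last by rewrite mul0r.
by rewrite M0 ?enum_valP ?mulr0.
Qed.

Section BipartiteMatrix.
Variables (D : {set 'I_n}) (A : 'M[int]_n).
Hypothesis A0 : forall i j, (i \in D) = (j \in D) -> A i j = 0.
Let R := selection D.

Lemma selection_bipartite : R *m R^T *m A + A *m (R *m R^T) = A.
Proof.
rewrite selection_mul_tr; apply/matrixP => i j; rewrite mxE.
have -> : ((\matrix_(i, j) ((i == j) && (i \in D))%:R) *m A) i j = (i \in D)%:R * A i j.
  rewrite mxE (bigD1 i) //= big1 => [|l li]; first by rewrite mxE eqxx addr0.
  by rewrite mxE eq_sym (negPf li) mul0r.
have -> : (A *m \matrix_(i, j) ((i == j) && (i \in D))%:R) i j = A i j * (j \in D)%:R.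
  rewrite mxE (bigD1 j) //= big1 => [|l lj]; first by rewrite mxE eqxx addr0.
  by rewrite mxE (negPf lj) mulr0.
have [e|] := eqVneq (i \in D) (j \in D); first by rewrite A0 // mul0r mulr0 addr0.
by case: (i \in D); case: (j \in D) => // _; rewrite ?mul1r ?mulr1 ?mul0r ?mulr0 ?addr0 ?add0r.
Qed.

Lemma char_poly_selection :
  'X ^+ #|D| * char_poly A
    = 'X ^+ #|~: D| * (char_poly (R^T *m (A *m A) *m R) \Po 'X^2).
Proof.
apply: (@char_poly_bipartite _ _ _ _ _ (selection (~: D))).
- by rewrite cardsC card_ord.
- rewrite !selection_mul_tr; apply/matrixP => i j; rewrite !mxE inE.
  by case: (i \in D); rewrite ?andbT ?andbF ?addr0 ?add0r.
- by apply: selection_block => i j iD jD; apply: A0; rewrite iD jD.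
- apply: selection_block => i j; rewrite !inE => /negPf iD /negPf jD.
  by apply: A0; rewrite iD jD.
Qed.

End BipartiteMatrix.

End Selection.

(** * Signed graphs *)

Section SignedGraph.
Variable n : nat.
Implicit Types S T : signed_graph n.

Lemma adjmx_sym S : (adjmx S)^T = adjmx S.
Proof.
by apply/matrixP => i j; rewrite !mxE adj_sym; case: ifP => // /sign_sym.
Qed.

Lemma adjmx_neq0 S i j : (adjmx S i j != 0) = adj S i j.
Proof. by rewrite mxE; case: ifP => [/sign_pm1[] -> //|_]; rewrite eqxx. Qed.

Lemma isomorphic_perm S T (s : 'S_n) :
  (forall i j, adjmx S i j = adjmx T (s i) (s j)) -> isomorphic S T.
Proof.
move=> ST; have adjST i j : adj S i j = adj T (s i) (s j) by rewrite -!adjmx_neq0 ST.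
exists s; split=> // i j ij; have := ST i j.
by rewrite !mxE -adjST ij.
Qed.

Lemma bipartite_smaller_class S : bipartite S -> exists D : {set 'I_n},
  (#|D| <= #|~: D|)%N /\ forall i j, (i \in D) = (j \in D) -> adjmx S i j = 0.
Proof.
case=> c cS; wlog lec : c cS / (#|[set i | c i]| <= #|~: [set i | c i]|)%N.
  move=> wl; have [|/ltnW gt] := leqP #|[set i | c i]| #|~: [set i | c i]|.
    exact: wl.
  apply: (wl (fun i => ~~ c i)) => [i j /cS|]; first by rewrite (inj_eq negb_inj).
  have -> : [set i | ~~ c i] = ~: [set i | c i] by apply/setP => i; rewrite !inE.
  by rewrite setCK.
exists [set i | c i]; split=> // i j; rewrite !inE => cij.
by rewrite mxE; case: ifP => // /cS; rewrite cij eqxx.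
Qed.

End SignedGraph.

Lemma DGS_of_half_square n k (S : signed_graph n.+1) (R : 'M[int]_(n.+1, k.+1))
    (A := adjmx S) (phi := char_poly (R^T *m (A *m A) *m R)) :
  R^T *m R = 1%:M -> R *m R^T *m A + A *m (R *m R^T) = A ->
  chi S = phi \Po 'X^2 \/ chi S = 'X * (phi \Po 'X^2) ->
  phi`_0 = 1 \/ phi`_0 = -1 ->
  (exists m : int, 2%:R ^- k.+1 * sqrtC (Delta S) = m%:~R /\ squarefree m) ->
  controllable S \/ almost_controllable S -> DGS S.
Proof.
move=> RR bipA chi_cases phi0 [m [em sqfree]] hctrl T [eST eJST].
have symA : A^T = A := adjmx_sym S.
have em' := discr_horner_mx chi_cases phi0 em.
have sqC p : prime p ->
    ~~ (p%:Z ^+ 2 %| \det (horner_mx (R^T *m (A *m A) *m R) phi^`()))%Z.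
  move=> p_pr; apply/negP => pC; have : p%:Z \is a GRing.unit.
    apply: sqfree; rewrite dvdzE.
    suff -> : absz m = absz (\det (horner_mx (R^T *m (A *m A) *m R) phi^`())) by [].
    by apply/eqP; rewrite -eqz_nat !abszE em'.
  by rewrite qualifE /=; have := prime_gt1 p_pr; lia.
have rk : \rank (map_mx (intr : int -> rat) (walk_matrix A)) = n.+1 \/
    (\rank (map_mx (intr : int -> rat) (walk_matrix A))).+1 = n.+1 by [].
have [Q [QQ QA Q1]] := walk_orthogonal symA (adjmx_sym T) (esym eST) (esym eJST) rk.
have [Z eQ] := orthogonal_conj_integral symA RR bipA (erefl _) chi_cases phi0 sqC QQ QA.
have ZZ : Z *m Z^T = 1%:M.
  by apply: ratmx_inj; rewrite map_mxM -map_trmx -eQ QQ map_mx1.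
have ZA : Z *m A = adjmx T *m Z by apply: ratmx_inj; rewrite !map_mxM -eQ.
have Z1 : Z *m const_mx 1 = const_mx 1 :> 'cV_n.+1.
  apply: ratmx_inj; rewrite map_mxM -eQ.
  have -> : map_mx intr (const_mx 1) = const_mx 1 :> 'cV[rat]_n.+1.
    by apply/matrixP => i j; rewrite !mxE.
  exact: Q1.
have [s eZ] := orthogonal_stochastic_perm ZZ Z1.
apply: (@isomorphic_perm _ _ _ s) => i j; move: ZA; rewrite eZ.
rewrite -row_permE -{2}[s]invgK -col_permE => /matrixP/(_ i (s j)).
by rewrite [LHS]mxE [RHS]mxE permK => <-.
Qed.

Theorem theorem2 (n : nat) (S : signed_graph n)
    (hbip : bipartite S)
    (hctrl : controllable S \/ almost_controllable S)
    (hcoef : (chi S)`_(if odd n then 1%N else 0%N) = 1 \/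
             (chi S)`_(if odd n then 1%N else 0%N) = -1)
    (hdisc : exists m : int,
        2%:R ^- n./2 * sqrtC (Delta S) = m%:~R /\ squarefree m) :
  DGS S.
Proof.
move=> T [eST eJST].
have [D [leD adj0]] := bipartite_smaller_class hbip.
set A := adjmx S; set R := selection D.
have cardD : (#|D| + #|~: D|)%N = n by rewrite cardsC card_ord.
pose phi := char_poly (R^T *m (A *m A) *m R).
have chiE : chi S = 'X ^+ (#|~: D| - #|D|) * (phi \Po 'X^2).
  apply: (mulfI (expf_neq0 #|D| (monic_neq0 (monicX _)))).
  by rewrite (char_poly_selection adj0) mulrA -exprD subnKC.
(* The exponent has the parity of [n], and a larger one than [odd n] would make the coefficient in
   [hcoef] vanish. *)
have [eD phi0] : (#|~: D| - #|D|)%N = odd n /\ (phi`_0 = 1 \/ phi`_0 = -1).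
  have oddD : odd (#|~: D| - #|D|) = odd n by rewrite oddB // -oddD addnC cardD.
  move: hcoef; rewrite chiE coefXnM; case: ltnP => [_ []//|le] h.
  have eD : (#|~: D| - #|D|)%N = odd n by move: le oddD; case: (odd n); lia.
  split=> //; move: h; rewrite eD; case: (odd n); rewrite subnn coef0_comp_X2 //.
have chi_cases : chi S = phi \Po 'X^2 \/ chi S = 'X * (phi \Po 'X^2).
  by rewrite chiE eD; case: (odd n); rewrite ?expr0 ?expr1 ?mul1r; [right | left].
have halfn : n./2 = #|D| by lia.
have RR : R^T *m R = 1%:M := tr_selection_mul D.
have bipA : R *m R^T *m A + A *m (R *m R^T) = A := selection_bipartite adj0.
(* With at most one vertex there are no edges; the smaller class is then empty and carries no matrix
   of positive size. *)
have [n1|n2] := leqP n 1.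
  have adjF (U : signed_graph n) i j : adj U i j = false.
    suff -> : i = j by rewrite adj_irrefl.
    by apply/val_inj => /=; have := ltn_ord i; have := ltn_ord j; lia.
  by exists 1%g; split=> i j; rewrite !adjF.
move: hdisc phi0 chi_cases RR bipA; rewrite halfn /phi /A.
have : (0 < #|D|)%N by lia.
clear - hctrl eST eJST n2; clearbody R; move: #|D| R => [//|k] R _.
clear D.
case: n S hctrl T eST eJST R n2 => // n S hctrl T eST eJST R _.
move=> hdisc phi0 chi_cases RR bipA.
by have := DGS_of_half_square RR bipA chi_cases phi0 hdisc hctrl; apply; split.
Qed.
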